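(* Let $\kappa \le 0$, let $X$ be a CBB$(\kappa)$ space, let $Y$ be a complete CAT$(\kappa)$ space and let $A \subseteq X$ be nonempty. Then there exists a continuous mapping $\alpha : \mathcal{N}(A,Y) \to \mathcal{N}(X,Y)$ such that for all $g \in \mathcal{N}(A,Y)$, $\alpha(g)(a) = g(a)$ for every $a \in A$.
   Context: For $\kappa\le0$, $M^2_\kappa$ is the complete simply connected surface of constant curvature $\kappa$. A geodesic space is CAT$(\kappa)$ if every geodesic triangle satisfies: distances between points on the triangle are $\le$ distances between corresponding points of its comparison triangle in $M^2_\kappa$; it is CBB$(\kappa)$ if the reversed inequality ($\ge$) holds for all geodesic triangles. $\mathcal{N}(A,Y)$ is the set of bounded nonexpansive ($1$-Lipschitz) maps $A\to Y$, with the supremum metric $d_\infty(f,g)=\sup_{x\in A}d_Y(f(x),g(x))$; continuity of $\alpha$ refers to these metrics. *)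

(* Defs.v *)
From Stdlib Require Import Reals.
Open Scope R_scope.

Record MetricSpace := {
  mcar :> Type;
  mdist : mcar -> mcar -> R;
  mdist_eq0 : forall x y, mdist x y = 0 <-> x = y;
  mdist_sym : forall x y, mdist x y = mdist y x;
  mdist_tri : forall x y z, mdist x z <= mdist x y + mdist y z
}.
Arguments mdist {m}.

Definition is_geodesic {X : MetricSpace} (x y : X) (g : R -> X) : Prop :=
  g 0 = x /\ g (mdist x y) = y /\
  forall s t, 0 <= s <= mdist x y -> 0 <= t <= mdist x y ->
    mdist (g s) (g t) = Rabs (s - t).

Definition geodesic_space (X : MetricSpace) : Prop :=
  forall x y : X, exists g, is_geodesic x y g.

Definition complete (X : MetricSpace) : Prop :=
  forall u : nat -> X,
    (forall eps, 0 < eps -> exists N, forall m n, (N <= m)%nat -> (N <= n)%nat ->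
        mdist (u m) (u n) < eps) ->
    exists l : X, forall eps, 0 < eps -> exists N, forall n, (N <= n)%nat ->
        mdist (u n) l < eps.

(** The model plane M^2_kappa for kappa <= 0, realised inside R^3:
    kappa = 0 : the plane {x0 = 0} with the Euclidean distance on (x1,x2);
    kappa < 0 : the upper sheet of the hyperboloid -x0^2+x1^2+x2^2 = -1,
                with distance arcosh(x0 y0 - x1 y1 - x2 y2) / sqrt(-kappa). *)
Definition arcosh (z : R) : R := ln (z + sqrt (z * z - 1)).

Definition Mpt := (R * R * R)%type.

Definition in_model (kappa : R) (p : Mpt) : Prop :=
  let '(x0, x1, x2) := p in
  if Req_EM_T kappa 0 then x0 = 0
  else 0 < x0 /\ - (x0 * x0) + x1 * x1 + x2 * x2 = -1.

Definition model_dist (kappa : R) (p q : Mpt) : R :=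
  let '(x0, x1, x2) := p in
  let '(y0, y1, y2) := q in
  if Req_EM_T kappa 0 then sqrt ((x1 - y1) ^ 2 + (x2 - y2) ^ 2)
  else arcosh (x0 * y0 - x1 * y1 - x2 * y2) / sqrt (- kappa).

Inductive idx3 := I0 | I1 | I2.
Definition nxt (i : idx3) : idx3 := match i with I0 => I1 | I1 => I2 | I2 => I0 end.

(** Triangle comparison with respect to a relation [cmp]
    (Rle for CAT(kappa), Rge for CBB(kappa)).
    A geodesic triangle: vertices v i and sides g i, a geodesic from
    v i to v (nxt i).  A comparison triangle: points w i of M^2_kappa with the
    same pairwise distances.  The comparison point of g i t (0 <= t <= L_i) is
    the point z of M^2_kappa on the segment [w i, w (nxt i)] with
    d(w i, z) = t, i.e. d(w i,z) = t and d(z, w (nxt i)) = L_i - t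
    (segments in M^2_kappa are unique, so this characterises it). *)
Definition triangle_comparison (kappa : R) (cmp : R -> R -> Prop)
    (X : MetricSpace) : Prop :=
  forall (v : idx3 -> X) (g : idx3 -> R -> X),
    (forall i, is_geodesic (v i) (v (nxt i)) (g i)) ->
  forall (w : idx3 -> Mpt),
    (forall i, in_model kappa (w i)) ->
    (forall i j, model_dist kappa (w i) (w j) = mdist (v i) (v j)) ->
  forall i j s t (zs zt : Mpt),
    0 <= s <= mdist (v i) (v (nxt i)) ->
    0 <= t <= mdist (v j) (v (nxt j)) ->
    in_model kappa zs -> in_model kappa zt ->
    model_dist kappa (w i) zs = s ->
    model_dist kappa zs (w (nxt i)) = mdist (v i) (v (nxt i)) - s ->
    model_dist kappa (w j) zt = t ->
    model_dist kappa zt (w (nxt j)) = mdist (v j) (v (nxt j)) - t ->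
    cmp (mdist (g i s) (g j t)) (model_dist kappa zs zt).

Definition CAT (kappa : R) (X : MetricSpace) : Prop :=
  geodesic_space X /\ triangle_comparison kappa Rle X.

Definition CBB (kappa : R) (X : MetricSpace) : Prop :=
  geodesic_space X /\ triangle_comparison kappa Rge X.

Definition bounded {D : Type} {Y : MetricSpace} (f : D -> Y) : Prop :=
  exists M, forall x x', mdist (f x) (f x') <= M.

Definition nonexpansive {D : Type} (dD : D -> D -> R) {Y : MetricSpace}
    (f : D -> Y) : Prop :=
  forall x x', mdist (f x) (f x') <= dD x x'.

Definition inN {D : Type} (dD : D -> D -> R) {Y : MetricSpace} (f : D -> Y) : Prop :=
  bounded f /\ nonexpansive dD f.

Definition sub (X : MetricSpace) (A : X -> Prop) := {x : X | A x}.
Definition sub_dist (X : MetricSpace) (A : X -> Prop) (a b : sub X A) : R :=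
  mdist (proj1_sig a) (proj1_sig b).

Definition sup_le {D : Type} {Y : MetricSpace} (f g : D -> Y) (r : R) : Prop :=
  forall x, mdist (f x) (g x) <= r.

(* Main.v *)
Require Import Defs.
From Stdlib Require Import Reals Lra Psatz List ClassicalEpsilon.
From mathcomp Require classical_sets.
Import ListNotations.
Open Scope R_scope.

(* Write [F = d^2], [e = 0] if [kappa = 0], and [F = cosh (k d) - 1], [e = 1],
   [k = sqrt (- kappa)], otherwise.  In [X], the tangent cone at [p] is nonnegatively
   curved, which yields for all weights [m i >= 0] the Lang-Schroeder-Sturm inequality
     sum m_i m_j F (x_i, x_j) <= 2 (sum m_i) (sum m_i F (x_i, p)) + e (sum m_i F (x_i, p))^2.
   In [Y] the opposite inequality holds at a barycentre [p] of the weights, so comparing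
   the two at a point minimising the sum of the squares of the positive parts of
   [F (q, y_i) - F (p, x_i)] gives Kirszbraun's one-point extension.

   The inequality survives if a pseudo-metric [K] is added to [F], since
   [K_ij <= K_ip + K_jp].  Hence Kirszbraun's argument also works on the set of pairs
   [(g, x)], [g] in N(A,Y), [x] in [X], with the cost [F (x, y) + K (g, h)]: extending
   [(g, a) |-> g a] from N(A,Y) * A to N(A,Y) * X gives all extensions at once, with
   [F (alpha g x, alpha h x) <= K (g, h)].  It remains to find [K], continuous for the sup
   metric and large enough for [(g, a) |-> g a] to be admissible.  Requiring moreover
   that the constant map [y0] be extended by [y0] makes every [alpha g] bounded. *)

(** * Triangle comparison in the model plane *)

(** Neither space offers compactness. In [X] a sum of tangent directions need not be realised by a
    direction; it is approximated by the direction to the midpoint of two points running into [p],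
    and Gram sums are shown nonnegative up to an arbitrary [eps]. In [Y] an almost minimiser
    replaces the minimiser, finitely many constraints are treated at a time, and uniform convexity
    with completeness passes to all of them.

    The shape of [K] has its own obstacle. The slope of [F] is unbounded and N(A,Y) has no common
    bound, so the sup distance must be weighted by a slope; but a factor depending on [g] and [h]
    endangers the triangle inequality. The weight is therefore attached to a test point [w]: [K] is
    the supremum over [a] and [w] of a slope bound at [d(w, y0)] times
    [|min(d(g a, w), 1) - min(d(h a, w), 1)|]. For fixed [w] this is a pseudo-metric whatever the
    weight, and truncation at 1 silences the [w] far from both values, which keeps the supremum
    finite. *)

Lemma exp_opp_mul (x : R) : exp x * exp (- x) = 1.
Proof. rewrite <- exp_plus, Rplus_opp_r. apply exp_0. Qed.

Lemma cosh2_sinh2 (x : R) : cosh x * cosh x - sinh x * sinh x = 1.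
Proof. unfold cosh, sinh. pose proof (exp_opp_mul x). nra. Qed.

Lemma cosh_opp (x : R) : cosh (- x) = cosh x.
Proof. unfold cosh. rewrite Ropp_involutive. lra. Qed.

Lemma sinh_opp (x : R) : sinh (- x) = - sinh x.
Proof. unfold sinh. rewrite Ropp_involutive. lra. Qed.

Lemma cosh_plus (x y : R) : cosh (x + y) = cosh x * cosh y + sinh x * sinh y.
Proof. unfold cosh, sinh. rewrite Ropp_plus_distr, !exp_plus. field. Qed.

Lemma sinh_plus (x y : R) : sinh (x + y) = sinh x * cosh y + cosh x * sinh y.
Proof. unfold cosh, sinh. rewrite Ropp_plus_distr, !exp_plus. field. Qed.

Lemma cosh_minus (x y : R) : cosh (x - y) = cosh x * cosh y - sinh x * sinh y.
Proof. unfold Rminus. rewrite cosh_plus, cosh_opp, sinh_opp. ring. Qed.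

Lemma sinh_minus (x y : R) : sinh (x - y) = sinh x * cosh y - cosh x * sinh y.
Proof. unfold Rminus. rewrite sinh_plus, cosh_opp, sinh_opp. ring. Qed.

Lemma sinh_ge0 (x : R) : 0 <= x -> 0 <= sinh x.
Proof.
  intros [H | <-]; [| rewrite sinh_0; lra].
  rewrite <- sinh_0. apply Rlt_le, sinh_lt, H.
Qed.

Lemma sinh_gt0 (x : R) : 0 < x -> 0 < sinh x.
Proof. intros H. rewrite <- sinh_0. apply sinh_lt, H. Qed.

Lemma cosh_ge1 (x : R) : 1 <= cosh x.
Proof.
  unfold cosh. pose proof (exp_opp_mul x). pose proof (exp_pos x).
  pose proof (exp_pos (- x)). pose proof (Rle_0_sqr (exp x - exp (- x))).
  unfold Rsqr in *. nra.
Qed.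

Lemma cosh_le (x y : R) : 0 <= x -> x <= y -> cosh x <= cosh y.
Proof.
  intros Hx Hxy. replace y with (x + (y - x)) by ring. rewrite cosh_plus.
  pose proof (cosh_ge1 x). pose proof (cosh_ge1 (y - x)).
  pose proof (sinh_ge0 x Hx). assert (0 <= sinh (y - x)) by (apply sinh_ge0; lra).
  nra.
Qed.

Lemma cosh_lt (x y : R) : 0 <= x -> x < y -> cosh x < cosh y.
Proof.
  intros Hx Hxy. replace y with (x + (y - x)) by ring. rewrite cosh_plus.
  pose proof (cosh_ge1 x). pose proof (cosh2_sinh2 (y - x)).
  pose proof (cosh_ge1 (y - x)).
  pose proof (sinh_ge0 x Hx). assert (0 < sinh (y - x)) by (apply sinh_gt0; lra).
  assert (1 < cosh (y - x)) by nra. nra.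
Qed.

Lemma cosh_le_Rabs (x y : R) : Rabs x <= y -> cosh x <= cosh y.
Proof.
  intros H. destruct (Rle_dec 0 x) as [Hx | Hx].
  - rewrite Rabs_right in H by lra. apply cosh_le; lra.
  - rewrite Rabs_left in H by lra. rewrite <- cosh_opp. apply cosh_le; lra.
Qed.

Lemma cosh_le_inv (x y : R) : 0 <= y -> cosh x <= cosh y -> x <= y.
Proof.
  intros Hy H. destruct (Rle_dec x y) as [h | h]; [exact h | exfalso].
  assert (cosh y < cosh x) by (apply cosh_lt; lra). lra.
Qed.

Lemma arcosh_cosh (x : R) : 0 <= x -> arcosh (cosh x) = x.
Proof.
  intros Hx. unfold arcosh.
  replace (cosh x * cosh x - 1) with (sinh x * sinh x)
    by (pose proof (cosh2_sinh2 x); lra).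
  rewrite sqrt_square by (apply sinh_ge0, Hx).
  replace (cosh x + sinh x) with (exp x) by (unfold cosh, sinh; lra).
  apply ln_exp.
Qed.

Lemma cosh_onto (c : R) : 1 <= c -> exists x, 0 <= x /\ cosh x = c.
Proof.
  intros Hc.
  assert (Hs : 0 <= c * c - 1) by nra.
  exists (arcsinh (sqrt (c * c - 1))). split.
  - rewrite <- arcsinh_0. apply arcsinh_le, sqrt_pos.
  - set (y := arcsinh _). pose proof (cosh2_sinh2 y) as E.
    unfold y in E at 3 4. rewrite sinh_arcsinh, sqrt_sqrt in E by exact Hs.
    pose proof (cosh_ge1 y). nra.
Qed.

Lemma mdist_refl (X : MetricSpace) (x : X) : mdist x x = 0.
Proof. now apply mdist_eq0. Qed.

Lemma mdist_ge0 (X : MetricSpace) (x y : X) : 0 <= mdist x y.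
Proof.
  pose proof (mdist_tri X x y x) as H. rewrite (mdist_sym X y x), mdist_refl in H. lra.
Qed.

Lemma is_geodesic_start (X : MetricSpace) (x y : X) g s :
  is_geodesic x y g -> 0 <= s <= mdist x y -> mdist x (g s) = s.
Proof.
  intros (G0 & _ & G) Hs. rewrite <- G0 at 1.
  rewrite G by (pose proof (mdist_ge0 X x y); lra).
  rewrite Rminus_0_l, Rabs_Ropp, Rabs_right; lra.
Qed.

Lemma is_geodesic_initial (X : MetricSpace) (x y : X) g b :
  is_geodesic x y g -> 0 <= b <= mdist x y -> is_geodesic x (g b) g.
Proof.
  intros Hg Hb. unfold is_geodesic. rewrite (is_geodesic_start X x y g b Hg Hb).
  destruct Hg as (G0 & _ & G). split; [exact G0 | split; [reflexivity |]].
  intros s t Hs Ht. apply G; lra.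
Qed.

Definition tri {T : Type} (a b c : T) (i : idx3) : T :=
  match i with I0 => a | I1 => b | I2 => c end.

(** The only case of comparison used later. The vertex [z] enters as the point of parameter [0] on
    the side from [z] to [x]. Distances in the model are asked for in both orders, so that symmetry
    of [model_dist] never has to be proved. *)
Lemma vertex_comparison (kappa : R) (cmp : R -> R -> Prop) (X : MetricSpace)
    (x y z : X) (g : R -> X) (s : R) (w0 w1 w2 zs : Mpt) :
  geodesic_space X -> triangle_comparison kappa cmp X ->
  is_geodesic x y g -> 0 <= s <= mdist x y ->
  in_model kappa w0 -> in_model kappa w1 -> in_model kappa w2 -> in_model kappa zs ->
  model_dist kappa w0 w0 = 0 -> model_dist kappa w1 w1 = 0 -> model_dist kappa w2 w2 = 0 ->
  model_dist kappa w0 w1 = mdist x y -> model_dist kappa w1 w0 = mdist x y ->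
  model_dist kappa w1 w2 = mdist y z -> model_dist kappa w2 w1 = mdist y z ->
  model_dist kappa w2 w0 = mdist z x -> model_dist kappa w0 w2 = mdist z x ->
  model_dist kappa w0 zs = s -> model_dist kappa zs w1 = mdist x y - s ->
  cmp (mdist (g s) z) (model_dist kappa zs w2).
Proof.
  intros HX HT Hg Hs W0 W1 W2 Zs E00 E11 E22 E01 E10 E12 E21 E20 E02 Es0 Es1.
  destruct (HX y z) as [g1 Hg1], (HX z x) as [g2 Hg2].
  assert (E : g2 0 = z) by apply Hg2.
  rewrite <- E at 1.
  apply (HT (tri x y z) (tri g g1 g2)) with (w := tri w0 w1 w2) (i := I0) (j := I2);
    try assumption.
  - intros []; assumption.
  - intros []; assumption.
  - intros [] []; simpl; rewrite ?mdist_refl; try assumption;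
      rewrite mdist_sym; assumption.
  - simpl. pose proof (mdist_ge0 X z x). lra.
  - simpl. rewrite Rminus_0_r. exact E20.
Qed.

(** Stewart's theorem for the comparison triangle, [D] being its cevian. An abstract [cmp] serves
    CAT and CBB at once; when [x = y] the identity degenerates and reflexivity of [cmp] suffices. *)
Lemma euclidean_comparison (cmp : R -> R -> Prop) (X : MetricSpace)
    (x y z : X) (g : R -> X) (s : R) :
  (forall r, cmp r r) -> geodesic_space X -> triangle_comparison 0 cmp X ->
  is_geodesic x y g -> 0 <= s <= mdist x y ->
  exists D, 0 <= D /\ cmp (mdist (g s) z) D /\
    mdist x y * (D * D) = (mdist x y - s) * (mdist x z * mdist x z)
      + s * (mdist y z * mdist y z) - s * (mdist x y - s) * mdist x y.
Proof.
  intros Hr HX HT Hg Hs. pose proof (mdist_ge0 X x y) as HL.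
  destruct HL as [HL | HL].
  2:{ exists (mdist (g s) z). rewrite <- HL. split; [apply mdist_ge0 | split; [apply Hr |]].
      assert (s = 0) by lra. subst s. ring. }
  set (L := mdist x y) in *. set (b := mdist x z). set (a := mdist y z).
  pose proof (mdist_tri X x y z) as T1. pose proof (mdist_tri X x z y) as T2.
  pose proof (mdist_tri X y x z) as T3.
  rewrite (mdist_sym X z y) in T2. rewrite (mdist_sym X y x) in T3.
  pose proof (mdist_ge0 X x z) as Hb. pose proof (mdist_ge0 X y z) as Ha.
  fold L a b in T1, T2, T3, Hb, Ha.
  (* Comparison triangle [(0, 0)], [(L, 0)], [(u, v)]: [u] comes from the law of cosines, and the
     triangle inequalities give [- b <= u <= b], so that [v] is real. *)
  set (u := (L * L + b * b - a * a) / (2 * L)).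
  assert (Hu : 2 * L * u = L * L + b * b - a * a) by (unfold u; field; lra).
  assert (Hu2 : 0 <= b * b - u * u).
  { assert (0 <= (a - (L - b)) * (a + (L - b))) by (apply Rmult_le_pos; lra).
    assert (0 <= (L + b - a) * (L + b + a)) by (apply Rmult_le_pos; lra).
    assert (- b <= u) by (apply Rmult_le_reg_l with (2 * L); lra).
    assert (u <= b) by (apply Rmult_le_reg_l with (2 * L); lra).
    replace (b * b - u * u) with ((b - u) * (b + u)) by ring.
    apply Rmult_le_pos; lra. }
  set (v := sqrt (b * b - u * u)).
  assert (Hv : v * v = b * b - u * u) by (apply sqrt_sqrt; exact Hu2).
  assert (MD : forall p1 p2 q1 q2,
    model_dist 0 (0, p1, p2) (0, q1, q2) = sqrt ((p1 - q1) ^ 2 + (p2 - q2) ^ 2)).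
  { intros. unfold model_dist. destruct (Req_EM_T 0 0); [reflexivity | lra]. }
  assert (IM : forall p1 p2, in_model 0 (0, p1, p2)).
  { intros. unfold in_model. destruct (Req_EM_T 0 0); [reflexivity | lra]. }
  assert (SQ : forall t r, 0 <= r -> t = r * r -> sqrt t = r).
  { intros t r H0 ->. apply sqrt_square, H0. }
  exists (model_dist 0 (0, s, 0) (0, u, v)). split; [rewrite MD; apply sqrt_pos |]. split.
  - apply (vertex_comparison 0 cmp X x y z g s (0,0,0) (0,L,0) (0,u,v)); auto;
      rewrite MD; rewrite ?(mdist_sym X z x); fold L a b; apply SQ; try lra; nra.
  - rewrite MD, sqrt_sqrt by (apply Rplus_le_le_0_compat; apply pow2_ge_0).
    transitivity (L * (s * s) - s * (2 * L * u) + L * (u * u + v * v)); [ring |].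
    rewrite Hu, Hv. ring.
Qed.

(** Hyperbolic Stewart theorem. It is linear in the hyperbolic cosines because a point of a segment
    of the hyperboloid is a linear combination of the endpoints, and the cosine of a distance is a
    Minkowski product. *)
Lemma hyperbolic_comparison (kappa : R) (cmp : R -> R -> Prop) (X : MetricSpace)
    (x y z : X) (g : R -> X) (s : R) :
  let k := sqrt (- kappa) in
  kappa < 0 ->
  (forall r, cmp r r) -> geodesic_space X -> triangle_comparison kappa cmp X ->
  is_geodesic x y g -> 0 <= s <= mdist x y ->
  exists D, 0 <= D /\ cmp (mdist (g s) z) D /\
    sinh (k * mdist x y) * cosh (k * D) =
      sinh (k * (mdist x y - s)) * cosh (k * mdist x z)
      + sinh (k * s) * cosh (k * mdist y z).
Proof.
  intros k Hk0 Hr HX HT Hg Hs. pose proof (mdist_ge0 X x y) as HL.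
  assert (Hk : 0 < k) by (apply sqrt_lt_R0; lra).
  destruct HL as [HL | HL].
  2:{ exists (mdist (g s) z). rewrite <- HL. split; [apply mdist_ge0 | split; [apply Hr |]].
      assert (s = 0) by lra. subst s. rewrite Rminus_0_r, Rmult_0_r, sinh_0. ring. }
  set (L := mdist x y) in *. set (b := mdist x z). set (a := mdist y z).
  pose proof (mdist_tri X x y z) as T1. pose proof (mdist_tri X x z y) as T2.
  pose proof (mdist_tri X y x z) as T3.
  rewrite (mdist_sym X z y) in T2. rewrite (mdist_sym X y x) in T3.
  pose proof (mdist_ge0 X x z) as Hb. pose proof (mdist_ge0 X y z) as Ha.
  fold L a b in T1, T2, T3, Hb, Ha.
  assert (SL : 0 < sinh (k * L)) by (apply sinh_gt0; nra).
  assert (Sb : 0 <= sinh (k * b)) by (apply sinh_ge0; nra).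
  assert (Ss : 0 <= sinh (k * s)) by (apply sinh_ge0; nra).
  (* The third vertex will be [(cosh (k * b), u, v)]; by the law of cosines [u] is [sinh (k * b)]
     times the cosine of the angle at the first vertex [(1, 0, 0)]. [U1] and [U2] are the triangle
     inequalities, which put this cosine between -1 and 1. *)
  set (u := (cosh (k * L) * cosh (k * b) - cosh (k * a)) / sinh (k * L)).
  assert (Hu : sinh (k * L) * u = cosh (k * L) * cosh (k * b) - cosh (k * a))
    by (unfold u; field; lra).
  assert (U1 : cosh (k * L - k * b) <= cosh (k * a)).
  { apply cosh_le_Rabs. rewrite <- Rmult_minus_distr_l, Rabs_mult, (Rabs_right k) by lra.
    apply Rmult_le_compat_l; [lra |]. apply Rabs_le. lra. }
  assert (U2 : cosh (k * a) <= cosh (k * L + k * b)) by (apply cosh_le; nra).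
  rewrite cosh_minus in U1. rewrite cosh_plus in U2.
  assert (Hu1 : - sinh (k * b) <= u) by nra.
  assert (Hu2 : u <= sinh (k * b)) by nra.
  assert (Hu3 : 0 <= sinh (k * b) * sinh (k * b) - u * u) by nra.
  set (v := sqrt (sinh (k * b) * sinh (k * b) - u * u)).
  assert (Hv : v * v = sinh (k * b) * sinh (k * b) - u * u) by (apply sqrt_sqrt; exact Hu3).
  assert (MD : forall p0 p1 p2 q0 q1 q2 r, 0 <= r ->
    p0 * q0 - p1 * q1 - p2 * q2 = cosh (k * r) ->
    model_dist kappa (p0, p1, p2) (q0, q1, q2) = r).
  { intros p0 p1 p2 q0 q1 q2 r H0 H. unfold model_dist.
    destruct (Req_EM_T kappa 0); [lra |]. fold k. rewrite H.
    rewrite arcosh_cosh by nra. field. lra. }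
  assert (IM : forall p0 p1 p2, 1 <= p0 -> p0 * p0 - p1 * p1 - p2 * p2 = 1 ->
    in_model kappa (p0, p1, p2)).
  { intros. unfold in_model. destruct (Req_EM_T kappa 0); lra. }
  pose proof (cosh2_sinh2 (k * L)) as CL. pose proof (cosh2_sinh2 (k * s)) as Cs.
  pose proof (cosh2_sinh2 (k * b)) as Cb.
  pose proof (cosh_ge1 (k * L)). pose proof (cosh_ge1 (k * s)).
  pose proof (cosh_ge1 (k * b)).
  pose proof (cosh_ge1 (k * b - k * s)) as Cbs. rewrite cosh_minus in Cbs.
  (* The Minkowski product of the two points; since [u <= sinh (k * b)] it is at least
     [cosh (k * b - k * s)], hence at least [1]. *)
  destruct (cosh_onto (cosh (k * s) * cosh (k * b) - sinh (k * s) * u)) as (D & HD & ED).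
  { nra. }
  assert (EDk : k * (D / k) = D) by (field; lra).
  exists (model_dist kappa (cosh (k * s), sinh (k * s), 0) (cosh (k * b), u, v)).
  assert (EM : model_dist kappa (cosh (k * s), sinh (k * s), 0) (cosh (k * b), u, v) = D / k).
  { apply MD; [apply Rmult_le_pos; [exact HD | apply Rlt_le, Rinv_0_lt_compat, Hk] |].
    rewrite EDk, ED. ring. }
  split; [| split].
  - rewrite EM. apply Rmult_le_pos; [exact HD | apply Rlt_le, Rinv_0_lt_compat, Hk].
  - apply (vertex_comparison kappa cmp X x y z g s (1,0,0)
      (cosh (k * L), sinh (k * L), 0) (cosh (k * b), u, v)); auto;
      try (apply IM; lra);
      rewrite ?(mdist_sym X z x); fold L a b; apply MD;
      rewrite ?Rmult_0_r, ?cosh_0; try lra.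
    replace (k * (L - s)) with (k * L - k * s) by ring. rewrite cosh_minus. ring.
  - rewrite EM, EDk, ED.
    replace (k * (L - s)) with (k * L - k * s) by ring. rewrite sinh_minus.
    replace (cosh (k * a)) with (cosh (k * L) * cosh (k * b) - sinh (k * L) * u) by lra.
    ring.
Qed.

(* With sides [a], [b] and comparison angle [t] at [p], this is [2 a b cos t] for
   [F = d^2], [e = 0] and [sinh (k a) sinh (k b) cos t] for [F = cosh (k d) - 1], [e = 1]. *)
Definition hinge (e : R) {X : Type} (F : X -> X -> R) (p x y : X) : R :=
  F x p + F y p + e * F x p * F y p - F x y.

(** What the tangent cone needs from CBB, freed of [kappa] and of geodesics. [cbb_mid] is comparison
    at a midpoint; [cbb_ray] is the monotonicity of comparison angles along a geodesic from [p],
    parametrised so that [hinge] is exactly bilinear on it; [cbb_low] says, without square roots,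
    that comparison cosines are at least -1. *)
Record cbb_kernel (e : R) {X : Type} (F : X -> X -> R) : Prop := {
  cbb_sym : forall x y, F x y = F y x;
  cbb_ge0 : forall x y, 0 <= F x y;
  cbb_refl : forall x, F x x = 0;
  cbb_mid : forall x y, exists m, F x m <= F x y / 4 /\
    forall z, (F z x + F z y) / 2 - F x y / 4 * (1 + e * ((F z x + F z y) / 2)) <= F z m;
  cbb_ray : forall p x, exists r : R -> X, r 1 = x /\
    (forall y s t, 0 < s -> s <= t -> t <= 1 ->
       t * hinge e F p (r s) y <= s * hinge e F p (r t) y) /\
    (forall s t, 0 < s <= 1 -> 0 < t <= 1 ->
       hinge e F p (r s) (r t) = s * t * hinge e F p x x);
  cbb_low : forall p x y s t, 0 < s -> 0 < t ->
    - (t * t * hinge e F p x x + s * s * hinge e F p y y)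
      <= 2 * (s * t) * hinge e F p x y
}.

(** Up to symmetry of [F], the coefficient of [t] in [cat_first_order] is [- hinge e F q z y], the
    first variation as [q] moves towards [z]. In its error term [F q z * (2 + F q z)] is the square
    of [sinh (k d)] for the hyperbolic cost. [cat_convex] is uniform convexity, with one gap [mu]
    for all [y]. *)
Record cat_kernel (e : R) (Y : MetricSpace) (F : Y -> Y -> R) : Prop := {
  cat_sym : forall x y, F x y = F y x;
  cat_ge0 : forall x y, 0 <= F x y;
  cat_first_order : forall q z t, 0 < t <= 1 -> exists w, forall y,
    F w y <= F q y + t * (F z y - F q y - F q z * (1 + e * F q y))
      + t * t * (F q z * (2 + F q z) * (1 + e * F q y));
  cat_convex : forall eps, 0 < eps -> exists mu, 0 < mu /\
    forall q z, eps <= mdist q z -> exists w, forall y,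
      F w y <= (F q y + F z y) / 2 - mu;
  cat_closed : forall q y c,
    (forall delta, 0 < delta -> exists q', mdist q q' < delta /\ F q' y <= c + delta) ->
    F q y <= c
}.

(* [q R0] bounds the values and the slopes of [f] between [0] and [2 * R0]. *)
Record gauge (f : R -> R) : Prop := {
  gauge_zero : f 0 = 0;
  gauge_le_inv : forall r s, 0 <= r -> 0 <= s -> f r <= f s -> r <= s;
  gauge_pos : forall r, 0 < r -> 0 < f r;
  gauge_proper : forall B, exists M, forall r, 0 <= r -> f r <= B -> r <= M;
  gauge_mono : forall r s, 0 <= r -> r <= s -> f r <= f s;
  gauge_slope : exists q, (forall r, 0 <= r -> 0 <= q r) /\
    (forall r s, 0 <= r -> r <= s -> q r <= q s) /\
    forall R0 r r' d, 0 <= r <= 2 * R0 -> 0 <= r' -> 0 <= d -> r <= r' + d ->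
      f r - f r' <= q R0 * Rmin d 1
}.

(** * The flat and the hyperbolic cost *)

Definition sqf (r : R) : R := r * r.
Definition coshf (k r : R) : R := cosh (k * r) - 1.

Lemma gauge_sqf : gauge sqf.
Proof.
  unfold sqf. split.
  - ring.
  - intros. nra.
  - intros. nra.
  - intros B. exists (Rabs B + 1). intros r Hr H. pose proof (Rle_abs B).
    pose proof (Rabs_pos B). nra.
  - intros. nra.
  - exists (fun r => 4 * r * r + 4 * r). split; [| split].
    + intros; nra.
    + intros; nra.
    + intros R0 r r' d Hr Hr' Hd H.
      destruct (Rle_dec d 1).
      * rewrite Rmin_left by lra.
        assert (r * r - r' * r' <= d * (4 * R0)).
        { destruct (Rle_dec r r'); [nra |].
          replace (r * r - r' * r') with ((r - r') * (r + r')) by ring.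
          apply Rmult_le_compat; lra. }
        nra.
      * rewrite Rmin_right by lra. nra.
Qed.

Lemma cosh_sub_le (x y : R) : cosh x - cosh y <= sinh x * (x - y).
Proof.
  assert (H : 1 + (y - x) <= exp (y - x)) by apply exp_ineq1_le.
  assert (H' : 1 + (x - y) <= exp (x - y)) by apply exp_ineq1_le.
  assert (E1 : exp y = exp x * exp (y - x)) by (rewrite <- exp_plus; f_equal; ring).
  assert (E2 : exp (- y) = exp (- x) * exp (x - y))
    by (rewrite <- exp_plus; f_equal; ring).
  unfold cosh, sinh. rewrite E1, E2.
  pose proof (exp_pos x). pose proof (exp_pos (- x)). nra.
Qed.

Lemma cosh_ge_linear (x : R) : x <= cosh x.
Proof.
  unfold cosh. pose proof (exp_ineq1_le x). pose proof (exp_pos (- x)).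
  pose proof (exp_ineq1_le (x / 2)).
  assert (E : exp x = exp (x / 2) * exp (x / 2)) by (rewrite <- exp_plus; f_equal; field).
  destruct (Rle_dec x 0); [pose proof (exp_pos x); lra |].
  assert ((1 + x / 2) * (1 + x / 2) <= exp (x / 2) * exp (x / 2))
    by (apply Rmult_le_compat; lra).
  pose proof (Rle_0_sqr (x - 2)) as Q. unfold Rsqr in Q. lra.
Qed.

Lemma gauge_coshf (k : R) : 0 < k -> gauge (coshf k).
Proof.
  intros Hk. unfold coshf. split.
  - rewrite Rmult_0_r, cosh_0. ring.
  - intros r s Hr Hs H. apply Rmult_le_reg_l with k; [lra |].
    apply cosh_le_inv; [nra | lra].
  - intros r Hr. rewrite <- cosh_0. apply Rlt_0_minus, cosh_lt; nra.
  - intros B. exists ((B + 1) / k). intros r Hr H.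
    apply Rmult_le_reg_l with k; [lra |].
    replace (k * ((B + 1) / k)) with (B + 1) by (field; lra).
    pose proof (cosh_ge_linear (k * r)). lra.
  - intros r s Hr Hrs. assert (cosh (k * r) <= cosh (k * s)) by (apply cosh_le; nra). lra.
  - exists (fun r => cosh (k * (2 * r)) + k * sinh (k * (2 * r))). split; [| split].
    + intros r Hr. pose proof (cosh_ge1 (k * (2 * r))).
      assert (0 <= sinh (k * (2 * r))) by (apply sinh_ge0; nra). nra.
    + intros r s Hr [Hs | ->]; [| lra].
      assert (cosh (k * (2 * r)) <= cosh (k * (2 * s))) by (apply cosh_le; nra).
      assert (sinh (k * (2 * r)) < sinh (k * (2 * s))) by (apply sinh_lt; nra). nra.
    + intros R0 r r' d Hr Hr' Hd H.
      assert (H1 : cosh (k * r) <= cosh (k * (2 * R0))) by (apply cosh_le; nra).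
      pose proof (cosh_ge1 (k * r')). pose proof (cosh_ge1 (k * (2 * R0))).
      assert (H4 : 0 <= sinh (k * r)) by (apply sinh_ge0; nra).
      assert (H3 : sinh (k * r) <= sinh (k * (2 * R0))).
      { destruct Hr as [_ [h | ->]]; [| lra]. apply Rlt_le, sinh_lt. nra. }
      destruct (Rle_dec d 1).
      * rewrite Rmin_left by lra.
        pose proof (cosh_sub_le (k * r) (k * r')) as Hc.
        assert (sinh (k * r) * (k * r - k * r') <= sinh (k * r) * (k * d))
          by (apply Rmult_le_compat_l; nra).
        assert (sinh (k * r) * (k * d) <= sinh (k * (2 * R0)) * (k * d))
          by (apply Rmult_le_compat_r; nra).
        assert (0 <= cosh (k * (2 * R0)) * d) by nra.
        lra.
      * rewrite Rmin_right by lra. nra.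
Qed.

Lemma cbb_kernel_flat (X : MetricSpace) :
  CBB 0 X -> cbb_kernel 0 (fun x y : X => sqf (mdist x y)).
Proof.
  intros [HX HT].
  assert (St : forall (x y z : X) g s, is_geodesic x y g -> 0 <= s <= mdist x y ->
    (mdist x y - s) * sqf (mdist x z) + s * sqf (mdist y z)
      - s * (mdist x y - s) * mdist x y <= mdist x y * sqf (mdist (g s) z)).
  { intros x y z g s Hg Hs.
    destruct (euclidean_comparison Rge X x y z g s) as (D & HD & Hc & E); auto.
    { intros; apply Rle_refl. }
    unfold sqf. rewrite <- E. apply Rmult_le_compat_l; [apply mdist_ge0 |].
    apply Rge_le in Hc. nra. }
  split.
  - intros. now rewrite mdist_sym.
  - intros. apply Rle_0_sqr.
  - intros. rewrite mdist_refl. apply Rmult_0_l.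
  - intros x y. destruct (HX x y) as [g Hg]. pose proof (mdist_ge0 X x y) as HL.
    assert (Hs : 0 <= mdist x y / 2 <= mdist x y) by lra.
    exists (g (mdist x y / 2)). split.
    + rewrite (is_geodesic_start X x y g _ Hg Hs). unfold sqf. lra.
    + intros z. rewrite (mdist_sym X z x), (mdist_sym X z y), (mdist_sym X z).
      specialize (St x y z g _ Hg Hs). destruct HL as [HL | HL].
      * apply Rmult_le_reg_l with (mdist x y); [exact HL |]. unfold sqf in *. lra.
      * assert (y = x) by (symmetry; now apply mdist_eq0). subst y.
        rewrite <- HL. replace (0 / 2) with 0 by lra. destruct Hg as [-> _].
        unfold sqf. lra.
  - intros p x. destruct (HX p x) as [g Hg]. set (a := mdist p x).
    pose proof (mdist_ge0 X p x) as Ha. fold a in Ha.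
    assert (Hd : forall t, 0 <= t <= 1 -> mdist p (g (t * a)) = t * a)
      by (intros; apply (is_geodesic_start X p x); [exact Hg | fold a; nra]).
    exists (fun t => g (t * a)). split; [| split].
    + rewrite Rmult_1_l. apply Hg.
    + intros y s t Hs Hst Ht. unfold hinge.
      rewrite !(mdist_sym X _ p), !Hd by lra.
      destruct Ha as [Ha | Ha].
      2:{ rewrite <- Ha, !Rmult_0_r. destruct Hg as [-> _].
          unfold sqf. lra. }
      assert (Hta : 0 <= t * a <= mdist p x) by (fold a; nra).
      assert (Hsa : 0 <= s * a <= mdist p (g (t * a))) by (rewrite Hd by lra; nra).
      specialize (St p (g (t * a)) y g (s * a)
        (is_geodesic_initial X p x g _ Hg Hta) Hsa).
      rewrite Hd in St by lra. unfold sqf in *.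
      apply Rmult_le_reg_l with a; [exact Ha |]. nra.
    + intros s t Hs Ht. unfold hinge. rewrite !(mdist_sym X _ p), !Hd by lra.
      destruct Hg as (_ & _ & Hg). rewrite Hg by (fold a; nra).
      rewrite mdist_refl. fold a. unfold sqf. pose proof (Rsqr_abs (s * a - t * a)) as E.
      unfold Rsqr in E. rewrite <- E. ring.
  - intros p x y s t Hs Ht. unfold hinge, sqf. rewrite !mdist_refl.
    pose proof (mdist_tri X x p y) as T. rewrite (mdist_sym X p y) in T.
    pose proof (mdist_ge0 X x y). pose proof (mdist_ge0 X x p).
    pose proof (mdist_ge0 X y p).
    set (a := mdist x p) in *. set (b := mdist y p) in *. set (d := mdist x y) in *.
    assert (d * d <= (a + b) * (a + b)) by nra.
    assert (0 < s * t) by nra.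
    pose proof (Rle_0_sqr (t * a - s * b)) as Q. unfold Rsqr in Q. nra.
Qed.

Lemma cbb_kernel_hyperbolic (kappa : R) (X : MetricSpace) :
  kappa < 0 -> CBB kappa X ->
  cbb_kernel 1 (fun x y : X => coshf (sqrt (- kappa)) (mdist x y)).
Proof.
  intros Hk0 [HX HT]. assert (Hk : 0 < sqrt (- kappa)) by (apply sqrt_lt_R0; lra).
  set (k := sqrt (- kappa)) in *.
  assert (St : forall (x y z : X) g s, is_geodesic x y g -> 0 <= s <= mdist x y ->
    sinh (k * (mdist x y - s)) * cosh (k * mdist x z) + sinh (k * s) * cosh (k * mdist y z)
      <= sinh (k * mdist x y) * cosh (k * mdist (g s) z)).
  { intros x y z g s Hg Hs.
    destruct (hyperbolic_comparison kappa Rge X x y z g s) as (D & HD & Hc & E); auto.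
    { intros; apply Rle_refl. }
    fold k in E. rewrite <- E. apply Rmult_le_compat_l.
    - apply sinh_ge0. pose proof (mdist_ge0 X x y). nra.
    - apply Rge_le in Hc. apply cosh_le; nra. }
  split.
  - intros. now rewrite mdist_sym.
  - intros. unfold coshf. pose proof (cosh_ge1 (k * mdist x y)). lra.
  - intros. rewrite mdist_refl. unfold coshf. rewrite Rmult_0_r, cosh_0. ring.
  - intros x y. destruct (HX x y) as [g Hg]. pose proof (mdist_ge0 X x y) as HL.
    assert (Hs : 0 <= mdist x y / 2 <= mdist x y) by lra.
    set (u := cosh (k * (mdist x y / 2))).
    assert (Hu : 1 <= u) by apply cosh_ge1.
    assert (EL : k * mdist x y = k * (mdist x y / 2) + k * (mdist x y / 2)) by field.
    assert (EF : cosh (k * mdist x y) = 2 * (u * u) - 1).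
    { rewrite EL, cosh_plus. fold u. pose proof (cosh2_sinh2 (k * (mdist x y / 2))) as C.
      fold u in C. lra. }
    exists (g (mdist x y / 2)). unfold coshf. rewrite EF. split.
    + rewrite (is_geodesic_start X x y g _ Hg Hs). fold u. nra.
    + intros z. rewrite (mdist_sym X z x), (mdist_sym X z y), (mdist_sym X z).
      specialize (St x y z g _ Hg Hs). destruct HL as [HL | HL].
      * assert (S0 : 0 < sinh (k * (mdist x y / 2))) by (apply sinh_gt0; nra).
        rewrite EL, sinh_plus in St. fold u in St.
        replace (mdist x y - mdist x y / 2) with (mdist x y / 2) in St by field.
        set (S := sinh (k * (mdist x y / 2))) in *.
        set (cx := cosh (k * mdist x z)) in *. set (cy := cosh (k * mdist y z)) in *.
        set (cm := cosh (k * mdist (g (mdist x y / 2)) z)) in *.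
        assert (H1 : cx + cy <= 2 * u * cm) by (apply Rmult_le_reg_l with S; lra).
        pose proof (cosh_ge1 (k * mdist x z)) as Hx. fold cx in Hx.
        pose proof (cosh_ge1 (k * mdist y z)) as Hy. fold cy in Hy.
        (* [H1] bounds [cm] below with the factor [1 / u], whereas [cbb_mid] has [(3 - u^2) / 2];
           the latter is smaller because [u^3 - 3 u + 2 = (u - 1)^2 (u + 2)]. *)
        assert (H2 : 0 <= (u - 1) * (u - 1) * (u + 2)) by (apply Rmult_le_pos; nra).
        apply Rmult_le_reg_l with u; [lra |].
        assert (H3 : 0 <= (cx + cy) * ((u - 1) * (u - 1) * (u + 2)))
          by (apply Rmult_le_pos; lra).
        lra.
      * assert (y = x) by (symmetry; now apply mdist_eq0). subst y.
        unfold u. rewrite <- HL. replace (0 / 2) with 0 by lra. destruct Hg as [-> _].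
        rewrite Rmult_0_r, cosh_0. lra.
  - intros p x. destruct (HX p x) as [g Hg]. set (a := mdist p x).
    pose proof (mdist_ge0 X p x) as Ha. fold a in Ha.
    assert (Sa : 0 <= sinh (k * a)) by (apply sinh_ge0; nra).
    (* Hyperbolic hinges are products of hyperbolic sines with a cosine, so the parameter has to be
       proportional to [sinh (k d)] rather than to the distance [d] from [p]. *)
    set (h := fun t => arcsinh (t * sinh (k * a)) / k).
    assert (Ekh : forall t, sinh (k * h t) = t * sinh (k * a)).
    { intros t. unfold h. replace (k * (arcsinh (t * sinh (k * a)) / k))
        with (arcsinh (t * sinh (k * a))) by (field; lra). apply sinh_arcsinh. }
    assert (Hh : forall s t, 0 <= s -> s <= t -> h s <= h t).
    { intros. unfold h. apply Rmult_le_compat_r;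
        [apply Rlt_le, Rinv_0_lt_compat, Hk | apply arcsinh_le; nra]. }
    assert (H0 : h 0 = 0) by (unfold h; rewrite Rmult_0_l, arcsinh_0; lra).
    assert (H1 : h 1 = a) by (unfold h; rewrite Rmult_1_l, arcsinh_sinh; field; lra).
    assert (Hr : forall t, 0 <= t <= 1 -> 0 <= h t <= a).
    { intros t Ht. rewrite <- H0 at 1. rewrite <- H1. split; apply Hh; lra. }
    assert (Hd : forall t, 0 <= t <= 1 -> mdist p (g (h t)) = h t)
      by (intros; apply (is_geodesic_start X p x); [exact Hg | fold a; auto]).
    exists (fun t => g (h t)). split; [| split].
    + rewrite H1. apply Hg.
    + intros y s t Hs Hst Ht. unfold hinge, coshf.
      rewrite !(mdist_sym X _ p), !Hd by lra.
      destruct Ha as [Ha | Ha].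
      2:{ assert (E : forall t, h t = 0).
          { intros t'. unfold h. rewrite <- Ha, Rmult_0_r, sinh_0, Rmult_0_r, arcsinh_0. lra. }
          rewrite !E. destruct Hg as [-> _].
          rewrite Rmult_0_r, cosh_0. lra. }
      assert (Hta : 0 <= h t <= mdist p x) by (fold a; apply Hr; lra).
      assert (Hsa : 0 <= h s <= mdist p (g (h t))).
      { rewrite Hd by lra. split; [apply Hr; lra | apply Hh; lra]. }
      specialize (St p (g (h t)) y g (h s)
        (is_geodesic_initial X p x g _ Hg Hta) Hsa).
      rewrite Hd in St by lra.
      replace (k * (h t - h s)) with (k * h t - k * h s) in St by ring.
      rewrite sinh_minus, !Ekh in St.
      assert (Sa' : 0 < sinh (k * a)) by (apply sinh_gt0; nra).
      apply Rmult_le_reg_l with (sinh (k * a)); [exact Sa' |]. lra.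
    + intros s t Hs Ht. unfold hinge, coshf. rewrite !(mdist_sym X _ p), !Hd by lra.
      destruct Hg as (_ & _ & Hg). rewrite Hg by (fold a; apply Hr; lra).
      rewrite mdist_refl. fold a.
      assert (E : cosh (k * Rabs (h s - h t)) = cosh (k * h s - k * h t)).
      { unfold Rabs. destruct (Rcase_abs _).
        - rewrite <- cosh_opp. f_equal. ring.
        - f_equal. ring. }
      rewrite E, cosh_minus, !Ekh, Rmult_0_r, cosh_0.
      transitivity (s * t * (sinh (k * a) * sinh (k * a))); [ring |].
      replace (sinh (k * a) * sinh (k * a)) with (cosh (k * a) * cosh (k * a) - 1)
        by (pose proof (cosh2_sinh2 (k * a)); lra).
      ring.
  - intros p x y s t Hs Ht. unfold hinge, coshf. rewrite !mdist_refl, Rmult_0_r, cosh_0.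
    pose proof (mdist_tri X x p y) as T. rewrite (mdist_sym X p y) in T.
    pose proof (mdist_ge0 X x y). pose proof (mdist_ge0 X x p).
    pose proof (mdist_ge0 X y p).
    set (a := mdist x p) in *. set (b := mdist y p) in *. set (d := mdist x y) in *.
    assert (C : cosh (k * d) <= cosh (k * a + k * b)) by (apply cosh_le; nra).
    rewrite cosh_plus in C.
    pose proof (cosh2_sinh2 (k * a)). pose proof (cosh2_sinh2 (k * b)).
    assert (0 < s * t) by nra.
    pose proof (Rle_0_sqr (t * sinh (k * a) - s * sinh (k * b))) as Q. unfold Rsqr in Q.
    assert (s * t * cosh (k * d) <= s * t * (cosh (k * a) * cosh (k * b)
      + sinh (k * a) * sinh (k * b))) by (apply Rmult_le_compat_l; lra).
    assert (Ea : t * t * (cosh (k * a) * cosh (k * a)) = t * t * (1 + sinh (k * a) * sinh (k * a)))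
      by (f_equal; lra).
    assert (Eb : s * s * (cosh (k * b) * cosh (k * b)) = s * s * (1 + sinh (k * b) * sinh (k * b)))
      by (f_equal; lra).
    lra.
Qed.

Lemma le_of_forall_slope (a c B : R) :
  (forall d, 0 < d -> a <= c + B * d) -> a <= c.
Proof.
  intros H. destruct (Rle_dec a c) as [h | h]; [exact h | exfalso].
  set (d := (a - c) / (2 * (Rabs B + 1))).
  pose proof (Rabs_pos B). pose proof (Rle_abs B).
  assert (Hd : 0 < d) by (apply Rdiv_lt_0_compat; lra).
  specialize (H d Hd).
  assert (E : (Rabs B + 1) * d = (a - c) / 2) by (unfold d; field; lra).
  nra.
Qed.

Lemma gauge_closed (f : R -> R) (Y : MetricSpace) (q y : Y) (c : R) :
  gauge f ->
  (forall delta, 0 < delta -> exists q', mdist q q' < delta /\ f (mdist q' y) <= c + delta) ->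
  f (mdist q y) <= c.
Proof.
  intros Hf H. destruct (gauge_slope f Hf) as (s & s_pos & _ & Hs).
  pose proof (mdist_ge0 Y q y) as D0.
  apply le_of_forall_slope with (s (mdist q y) + 1). intros d Hd.
  destruct (H d Hd) as (q' & Hq & Hc).
  pose proof (mdist_tri Y q q' y) as T. pose proof (mdist_ge0 Y q' y).
  assert (Hm : f (mdist q y) - f (mdist q' y) <= s (mdist q y) * Rmin d 1)
    by (apply Hs; lra).
  pose proof (Rmin_l d 1). specialize (s_pos _ D0). nra.
Qed.

Lemma cat_kernel_flat (Y : MetricSpace) :
  CAT 0 Y -> cat_kernel 0 Y (fun x y => sqf (mdist x y)).
Proof.
  intros [HY HT].
  assert (St : forall (x y z : Y) g s, is_geodesic x y g -> 0 <= s <= mdist x y ->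
    mdist x y * sqf (mdist (g s) z) <=
    (mdist x y - s) * sqf (mdist x z) + s * sqf (mdist y z)
      - s * (mdist x y - s) * mdist x y).
  { intros x y z g s Hg Hs.
    destruct (euclidean_comparison Rle Y x y z g s) as (D & HD & Hc & E); auto.
    { intros; apply Rle_refl. }
    unfold sqf. rewrite <- E. apply Rmult_le_compat_l; [apply mdist_ge0 |].
    pose proof (mdist_ge0 Y (g s) z). nra. }
  split.
  - intros. now rewrite mdist_sym.
  - intros. apply Rle_0_sqr.
  - intros q z t Ht. destruct (HY q z) as [g Hg]. pose proof (mdist_ge0 Y q z) as HL.
    assert (Hs : 0 <= t * mdist q z <= mdist q z) by nra.
    exists (g (t * mdist q z)). intros y. specialize (St q z y g _ Hg Hs).
    assert (Hq : 0 <= t * t * (sqf (mdist q z) * sqf (mdist q z)))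
      by (apply Rmult_le_pos; apply Rle_0_sqr).
    assert (Hq' : 0 <= t * t * sqf (mdist q z))
      by (apply Rmult_le_pos; apply Rle_0_sqr).
    destruct HL as [HL | HL].
    + assert (sqf (mdist (g (t * mdist q z)) y) <= (1 - t) * sqf (mdist q y)
        + t * sqf (mdist z y) - t * (1 - t) * sqf (mdist q z)).
      { apply Rmult_le_reg_l with (mdist q z); [exact HL |]. unfold sqf in *. nra. }
      nra.
    + assert (z = q) by (symmetry; now apply mdist_eq0). subst z.
      rewrite <- HL, Rmult_0_r. destruct Hg as [-> _]. unfold sqf. lra.
  - intros eps He. exists (eps * eps / 4). split; [nra |]. intros q z Hqz.
    destruct (HY q z) as [g Hg]. assert (Hs : 0 <= mdist q z / 2 <= mdist q z) by lra.
    exists (g (mdist q z / 2)). intros y. specialize (St q z y g _ Hg Hs).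
    apply Rmult_le_reg_l with (mdist q z); [lra |]. unfold sqf in *.
    assert (eps * eps <= mdist q z * mdist q z) by nra. nra.
  - intros. now apply gauge_closed; [apply gauge_sqf |].
Qed.

Lemma cat_kernel_hyperbolic (kappa : R) (Y : MetricSpace) :
  kappa < 0 -> CAT kappa Y ->
  cat_kernel 1 Y (fun x y => coshf (sqrt (- kappa)) (mdist x y)).
Proof.
  intros Hk0 [HY HT]. assert (Hk : 0 < sqrt (- kappa)) by (apply sqrt_lt_R0; lra).
  set (k := sqrt (- kappa)) in *.
  assert (St : forall (x y z : Y) g s, is_geodesic x y g -> 0 <= s <= mdist x y ->
    sinh (k * mdist x y) * cosh (k * mdist (g s) z) <=
    sinh (k * (mdist x y - s)) * cosh (k * mdist x z) + sinh (k * s) * cosh (k * mdist y z)).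
  { intros x y z g s Hg Hs.
    destruct (hyperbolic_comparison kappa Rle Y x y z g s) as (D & HD & Hc & E); auto.
    { intros; apply Rle_refl. }
    fold k in E. rewrite <- E. pose proof (mdist_ge0 Y x y).
    pose proof (mdist_ge0 Y (g s) z). apply Rmult_le_compat_l.
    - apply sinh_ge0. nra.
    - apply cosh_le; nra. }
  split.
  - intros. now rewrite mdist_sym.
  - intros. unfold coshf. pose proof (cosh_ge1 (k * mdist x y)). lra.
  - intros q z t Ht. destruct (HY q z) as [g Hg]. pose proof (mdist_ge0 Y q z) as HL.
    destruct HL as [HL | HL].
    2:{ exists q. intros y. assert (z = q) by (symmetry; now apply mdist_eq0). subst z.
        unfold coshf. rewrite mdist_refl, Rmult_0_r, cosh_0.
        pose proof (cosh_ge1 (k * mdist q y)). lra. }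
    set (S := sinh (k * mdist q z)).
    assert (HS : 0 < S) by (apply sinh_gt0; nra).
    (* With this parameter Stewart's identity gives [cz] the weight exactly [t]. The weight
       [cs - t * cL] of [cq] exceeds [1 - t * cL] by [cs - 1 <= t^2 S^2], which becomes the error
       term. *)
    set (s := arcsinh (t * S) / k).
    assert (Eks : k * s = arcsinh (t * S)) by (unfold s; field; lra).
    assert (Es : sinh (k * s) = t * S) by (rewrite Eks; apply sinh_arcsinh).
    assert (Hs : 0 <= s <= mdist q z).
    { split; apply Rmult_le_reg_l with k; try lra; rewrite Eks.
      - rewrite Rmult_0_r, <- arcsinh_0. apply arcsinh_le. nra.
      - rewrite <- (arcsinh_sinh (k * mdist q z)). apply arcsinh_le. fold S. nra. }
    exists (g s). intros y. specialize (St q z y g s Hg Hs).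
    replace (k * (mdist q z - s)) with (k * mdist q z - k * s) in St by ring.
    rewrite sinh_minus, Es in St. fold S in St.
    pose proof (cosh2_sinh2 (k * s)) as Cs. rewrite Es in Cs.
    pose proof (cosh2_sinh2 (k * mdist q z)) as CL. fold S in CL.
    pose proof (cosh_ge1 (k * s)) as G1. pose proof (cosh_ge1 (k * mdist q y)) as G2.
    unfold coshf. set (cs := cosh (k * s)) in *. set (cL := cosh (k * mdist q z)) in *.
    set (cq := cosh (k * mdist q y)) in *. set (cz := cosh (k * mdist z y)) in *.
    set (cw := cosh (k * mdist (g s) y)) in *.
    assert (H1 : cw <= (cs - t * cL) * cq + t * cz)
      by (apply Rmult_le_reg_l with S; [exact HS | lra]).
    assert (H2 : cs <= 1 + t * t * (S * S)) by nra.
    assert (H3 : cs * cq <= (1 + t * t * (S * S)) * cq) by (apply Rmult_le_compat_r; lra).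
    replace (S * S) with (cL * cL - 1) in H3 by lra. lra.
  - intros eps He. set (u0 := cosh (k * (eps / 2))).
    assert (Hu0 : 1 < u0) by (unfold u0; rewrite <- cosh_0; apply cosh_lt; nra).
    (* The midpoint gains a factor [/ u0] on the average of two hyperbolic cosines; that average is
       at least [1], so the drop is at least [1 - / u0]. *)
    exists (1 - / u0). assert (Hi : / u0 < 1) by (rewrite <- Rinv_1; apply Rinv_lt_contravar; lra).
    split; [lra |]. intros q z Hqz.
    destruct (HY q z) as [g Hg]. assert (Hs : 0 <= mdist q z / 2 <= mdist q z) by lra.
    exists (g (mdist q z / 2)). intros y. specialize (St q z y g _ Hg Hs).
    assert (EL : k * mdist q z = k * (mdist q z / 2) + k * (mdist q z / 2)) by field.
    replace (mdist q z - mdist q z / 2) with (mdist q z / 2) in St by field.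
    rewrite EL, sinh_plus in St.
    assert (HS : 0 < sinh (k * (mdist q z / 2))) by (apply sinh_gt0; nra).
    assert (Hu : u0 <= cosh (k * (mdist q z / 2))) by (apply cosh_le; nra).
    unfold coshf. set (S := sinh (k * (mdist q z / 2))) in *.
    set (u := cosh (k * (mdist q z / 2))) in *.
    pose proof (cosh_ge1 (k * mdist q y)). pose proof (cosh_ge1 (k * mdist z y)).
    set (cq := cosh (k * mdist q y)) in *. set (cz := cosh (k * mdist z y)) in *.
    pose proof (cosh_ge1 (k * mdist (g (mdist q z / 2)) y)).
    set (cw := cosh (k * mdist (g (mdist q z / 2)) y)) in *.
    assert (H2 : 2 * u * cw <= cq + cz) by (apply Rmult_le_reg_l with S; lra).
    assert (H3 : 2 * u0 * cw <= cq + cz) by nra.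
    assert (H4 : cw <= / u0 * ((cq + cz) / 2)).
    { apply Rmult_le_reg_l with u0; [lra |]. rewrite <- Rmult_assoc, Rinv_r by lra. lra. }
    assert (0 < / u0) by (apply Rinv_0_lt_compat; lra). nra.
  - intros. now apply gauge_closed; [apply gauge_coshf |].
Qed.

(** * The tangent cone of a CBB space *)

Definition near0 (P : R -> Prop) : Prop :=
  exists t0, 0 < t0 /\ forall t, 0 < t <= t0 -> P t.

Lemma near0_and (P Q : R -> Prop) : near0 P -> near0 Q -> near0 (fun t => P t /\ Q t).
Proof.
  intros (s & Hs & HP) (t & Ht & HQ). exists (Rmin s t).
  split; [now apply Rmin_glb_lt |]. intros u Hu.
  pose proof (Rmin_l s t). pose proof (Rmin_r s t). split; [apply HP | apply HQ]; lra.
Qed.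

Lemma near0_imp (P Q : R -> Prop) :
  (forall t, 0 < t -> P t -> Q t) -> near0 P -> near0 Q.
Proof. intros H (s & Hs & HP). exists s. split; auto. intros t Ht. apply H; [lra | auto]. Qed.

Lemma near0_le (c d : R) : 0 < d -> near0 (fun t => c * t <= d).
Proof.
  intros Hd. exists (d / (Rabs c + 1)). pose proof (Rabs_pos c). pose proof (Rle_abs c).
  split; [apply Rdiv_lt_0_compat; lra |]. intros t [Ht Htd].
  assert (E : (Rabs c + 1) * (d / (Rabs c + 1)) = d) by (field; lra). nra.
Qed.

Lemma near0_list {I : Type} (P : I -> R -> Prop) (l : list I) :
  (forall i, In i l -> near0 (P i)) -> near0 (fun t => forall i, In i l -> P i t).
Proof.
  induction l as [| i l IH]; intros H.
  - exists 1. split; [lra |]. intros t _ i [].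
  - assert (H1 : near0 (P i)) by (apply H; now left).
    assert (H2 := IH (fun j Hj => H j (or_intror Hj))).
    apply near0_imp with (2 := near0_and _ _ H1 H2).
    intros t _ [h1 h2] j [<- | Hj]; auto.
Qed.

Lemma near0_ex (P : R -> Prop) : near0 P -> exists t, 0 < t /\ P t.
Proof. intros (t & Ht & H). exists t. split; [exact Ht | apply H; lra]. Qed.

(** One-sided: only upper bounds are claimed, so [Q] may be very negative. *)
Definition O2 (Q : R -> R) : Prop := exists C, 0 <= C /\ near0 (fun t => Q t <= C * (t * t)).
Definition o2 (Q : R -> R) : Prop :=
  forall eps, 0 < eps -> near0 (fun t => Q t <= eps * (t * t)).

Lemma o2_O2 (Q : R -> R) : o2 Q -> O2 Q.
Proof. intros H. exists 1. split; [lra | apply H; lra]. Qed.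

Lemma O2_le (Q Q' : R -> R) : near0 (fun t => Q t <= Q' t) -> O2 Q' -> O2 Q.
Proof.
  intros H (C & HC & H'). exists C. split; [exact HC |].
  apply near0_imp with (2 := near0_and _ _ H H'). intros t _ [h h']. lra.
Qed.

Lemma O2_plus (Q Q' : R -> R) : O2 Q -> O2 Q' -> O2 (fun t => Q t + Q' t).
Proof.
  intros (C & HC & H) (C' & HC' & H'). exists (C + C'). split; [lra |].
  apply near0_imp with (2 := near0_and _ _ H H'). intros t _ [h h']. lra.
Qed.

Lemma o2_plus (Q Q' : R -> R) : o2 Q -> o2 Q' -> o2 (fun t => Q t + Q' t).
Proof.
  intros H H' eps He.
  assert (He' : 0 < eps / 2) by lra.
  apply near0_imp with (2 := near0_and _ _ (H _ He') (H' _ He')). intros t _ [h h']. lra.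
Qed.

Lemma O2_scal (c : R) (Q : R -> R) : 0 <= c -> O2 Q -> O2 (fun t => c * Q t).
Proof.
  intros Hc (C & HC & H). exists (c * C). split; [nra |].
  apply near0_imp with (2 := H). intros t _ h.
  rewrite Rmult_assoc. now apply Rmult_le_compat_l.
Qed.

Lemma o2_scal (c : R) (Q : R -> R) : 0 <= c -> o2 Q -> o2 (fun t => c * Q t).
Proof.
  intros Hc H eps He.
  assert (He' : 0 < eps / (c + 1)) by (apply Rdiv_lt_0_compat; lra).
  apply near0_imp with (2 := H _ He'). intros t Ht h.
  assert (E : (c + 1) * (eps / (c + 1)) = eps) by (field; lra).
  apply Rle_trans with (c * (eps / (c + 1) * (t * t))); [now apply Rmult_le_compat_l |].
  assert (0 < t * t) by nra. nra.
Qed.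

Lemma O2_const (C : R) : O2 (fun t => C * (t * t)).
Proof.
  exists (Rabs C). split; [apply Rabs_pos |]. exists 1. split; [lra |]. intros t Ht.
  pose proof (Rle_abs C). apply Rmult_le_compat_r; nra.
Qed.

(** The product is of order [t^4]. This is how the curvature terms, all products of two costs,
    disappear in the tangent cone. *)
Lemma o2_mult (Q Q' : R -> R) :
  (forall t, 0 <= Q t) -> (forall t, 0 <= Q' t) -> O2 Q -> O2 Q' ->
  o2 (fun t => Q t * Q' t).
Proof.
  intros P P' (C & HC & H) (C' & HC' & H') eps He.
  assert (H1 : near0 (fun t => C * C' * t <= eps)) by now apply near0_le.
  assert (H2 : near0 (fun t => 1 * t <= 1)) by (apply near0_le; lra).
  apply near0_imp with (2 := near0_and _ _ (near0_and _ _ H H') (near0_and _ _ H1 H2)).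
  intros t Ht [[h h'] [h1 h2]].
  apply Rle_trans with (C * (t * t) * (C' * (t * t))); [now apply Rmult_le_compat |].
  replace (C * (t * t) * (C' * (t * t))) with ((C * C' * t) * t * (t * t)) by ring.
  apply Rmult_le_compat_r; [nra |].
  assert (0 <= C * C' * t) by (apply Rmult_le_pos; nra). nra.
Qed.

(** * Finite sums and double sums *)

Fixpoint lsum {I : Type} (g : I -> R) (l : list I) : R :=
  match l with nil => 0 | i :: l => g i + lsum g l end.

Lemma lsum_le {I : Type} (g h : I -> R) (l : list I) :
  (forall i, In i l -> g i <= h i) -> lsum g l <= lsum h l.
Proof.
  induction l as [| i l IH]; intros H; simpl; [lra |].
  pose proof (H i (or_introl eq_refl)). pose proof (IH (fun j Hj => H j (or_intror Hj))). lra.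
Qed.

Lemma lsum_ext {I : Type} (g h : I -> R) (l : list I) :
  (forall i, In i l -> g i = h i) -> lsum g l = lsum h l.
Proof. intros H. apply Rle_antisym; apply lsum_le; intros; rewrite H by assumption; lra. Qed.

Lemma lsum_plus {I : Type} (g h : I -> R) (l : list I) :
  lsum (fun i => g i + h i) l = lsum g l + lsum h l.
Proof. induction l as [| i l IH]; simpl; [lra | rewrite IH; lra]. Qed.

Lemma lsum_scal {I : Type} (c : R) (g : I -> R) (l : list I) :
  lsum (fun i => c * g i) l = c * lsum g l.
Proof. induction l as [| i l IH]; simpl; [lra | rewrite IH; lra]. Qed.

Lemma lsum_ge0 {I : Type} (g : I -> R) (l : list I) :
  (forall i, In i l -> 0 <= g i) -> 0 <= lsum g l.
Proof.
  intros H. replace 0 with (lsum (fun _ : I => 0 * 0) l); [apply lsum_le; intros; rewrite Rmult_0_l; auto |].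
  rewrite lsum_scal. lra.
Qed.

Lemma lsum_map {I J : Type} (h : J -> I) (g : I -> R) (l : list J) :
  lsum g (map h l) = lsum (fun j => g (h j)) l.
Proof. induction l as [| i l IH]; simpl; [reflexivity | now rewrite IH]. Qed.

Definition dsum {I : Type} (g : I -> I -> R) (l : list I) : R :=
  lsum (fun i => lsum (g i) l) l.

Lemma dsum_cons {I : Type} (g : I -> I -> R) (i : I) (l : list I) :
  (forall j, In j l -> g j i = g i j) ->
  dsum g (i :: l) = g i i + 2 * lsum (g i) l + dsum g l.
Proof.
  intros H. unfold dsum. simpl. rewrite lsum_plus.
  rewrite (lsum_ext (fun j => g j i) (g i)) by exact H. lra.
Qed.

Section TangentCone.
Context (e : R) (X : Type) (F : X -> X -> R) (p : X).
Hypothesis e_ge0 : 0 <= e.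
Hypothesis HF : cbb_kernel e F.

Notation hip := (hinge e F p).
Notation n u := (F u p).

Definition is_ray (r : R -> X) : Prop :=
  (forall y s t, 0 < s -> s <= t -> t <= 1 -> t * hip (r s) y <= s * hip (r t) y) /\
  (forall s t, 0 < s <= 1 -> 0 < t <= 1 -> hip (r s) (r t) = s * t * hip (r 1) (r 1)).

Lemma ray_through (x : X) : exists r, r 1 = x /\ is_ray r.
Proof.
  destruct (cbb_ray e F HF p x) as (r & <- & H1 & H2). exists r. repeat split; assumption.
Qed.

Lemma hinge_sym (x y : X) : hip x y = hip y x.
Proof. unfold hinge. rewrite (cbb_sym e F HF x y). ring. Qed.

Lemma hinge_self (x : X) : hip x x = 2 * n x + e * n x * n x.
Proof. unfold hinge. rewrite (cbb_refl e F HF). ring. Qed.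

(* The inner product of the directions of two rays in the tangent cone at [p]. *)
Definition is_ip (r r' : R -> X) (v : R) : Prop :=
  (forall s t, 0 < s <= 1 -> 0 < t <= 1 -> s * t * v <= hip (r s) (r' t)) /\
  (forall eps, 0 < eps -> exists s0, 0 < s0 <= 1 /\
     forall s t, 0 < s <= s0 -> 0 < t <= s0 -> hip (r s) (r' t) <= s * t * (v + eps)).

(** The value is the infimum of the quotients [hip (r s) (r' t) / (s * t)], finite by [cbb_low].
    They are nondecreasing in [s] and in [t], so one pair that nearly attains the infimum controls
    all smaller pairs and the infimum is a limit. The signs are reversed because [completeness]
    gives suprema. *)
Lemma ip_exists (r r' : R -> X) : is_ray r -> is_ray r' -> exists v, is_ip r r' v.
Proof.
  intros [Hr1 Hr2] [Hr1' Hr2'].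
  set (E := fun v => exists s t, 0 < s <= 1 /\ 0 < t <= 1 /\ v = - (hip (r s) (r' t) / (s * t))).
  destruct (completeness E) as [v [Hub Hlub]].
  - exists ((hip (r 1) (r 1) + hip (r' 1) (r' 1)) / 2).
    intros v (s & t & Hs & Ht & ->).
    pose proof (cbb_low e F HF p (r s) (r' t) s t ltac:(lra) ltac:(lra)) as L.
    rewrite Hr2, Hr2' in L by lra.
    assert (P : 0 < s * t) by nra.
    apply Rmult_le_reg_l with (2 * (s * t) * (s * t)); [nra |].
    replace (2 * (s * t) * (s * t) * - (hip (r s) (r' t) / (s * t)))
      with (- (2 * (s * t) * hip (r s) (r' t))) by (field; lra).
    lra.
  - exists (- (hip (r 1) (r' 1) / (1 * 1))), 1, 1. repeat split; lra.
  - exists (- v). split.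
    + intros s t Hs Ht. assert (P : 0 < s * t) by nra.
      assert (G : - (hip (r s) (r' t) / (s * t)) <= v) by (apply Hub; exists s, t; auto).
      apply Rmult_le_compat_l with (r := s * t) in G; [| lra].
      replace (s * t * - (hip (r s) (r' t) / (s * t))) with (- hip (r s) (r' t)) in G
        by (field; lra). lra.
    + intros eps He.
      destruct (classic (exists s t, 0 < s <= 1 /\ 0 < t <= 1 /\
        hip (r s) (r' t) / (s * t) < - v + eps)) as [(s1 & t1 & Hs1 & Ht1 & G) | N].
      * exists (Rmin s1 t1). pose proof (Rmin_l s1 t1). pose proof (Rmin_r s1 t1).
        split; [split; [apply Rmin_glb_lt; lra | lra] |]. intros s t Hs Ht.
        assert (P : 0 < s1 * t1) by nra.
        assert (A1 : s1 * hip (r s) (r' t1) <= s * hip (r s1) (r' t1)) by (apply Hr1; lra).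
        assert (A2 : t1 * hip (r' t) (r s) <= t * hip (r' t1) (r s)) by (apply Hr1'; lra).
        rewrite (hinge_sym (r' t)), (hinge_sym (r' t1)) in A2.
        assert (G' : hip (r s1) (r' t1) <= s1 * t1 * (- v + eps)).
        { apply Rlt_le. apply Rmult_lt_compat_l with (r := s1 * t1) in G; [| lra].
          replace (s1 * t1 * (hip (r s1) (r' t1) / (s1 * t1))) with (hip (r s1) (r' t1)) in G
            by (field; lra). exact G. }
        apply Rmult_le_reg_l with (s1 * t1); [lra |].
        apply Rle_trans with (s1 * (t * hip (r s) (r' t1))); [|
          apply Rle_trans with (s * t * hip (r s1) (r' t1))].
        { rewrite Rmult_assoc. apply Rmult_le_compat_l; lra. }
        { replace (s1 * (t * hip (r s) (r' t1))) with (t * (s1 * hip (r s) (r' t1))) by ring.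
          replace (s * t * hip (r s1) (r' t1)) with (t * (s * hip (r s1) (r' t1))) by ring.
          apply Rmult_le_compat_l; lra. }
        { replace (s1 * t1 * (s * t * (- v + eps))) with (s * t * (s1 * t1 * (- v + eps)))
            by ring. apply Rmult_le_compat_l; [nra | exact G']. }
      * exfalso. assert (v <= v - eps); [| lra]. apply Hlub.
        intros w (s & t & Hs & Ht & ->).
        destruct (Rlt_dec (hip (r s) (r' t) / (s * t)) (- v + eps)); [| lra].
        exfalso. apply N. exists s, t. auto.
Qed.

Definition ip (r r' : R -> X) : R := epsilon (inhabits 0) (is_ip r r').

Lemma ip_spec (r r' : R -> X) : is_ray r -> is_ray r' -> is_ip r r' (ip r r').
Proof. intros Hr Hr'. unfold ip. apply epsilon_spec. now apply ip_exists. Qed.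

Lemma ip_le (r r' : R -> X) s t : is_ray r -> is_ray r' ->
  0 < s <= 1 -> 0 < t <= 1 -> s * t * ip r r' <= hip (r s) (r' t).
Proof. intros Hr Hr'. now apply ip_spec. Qed.

Lemma is_ip_le (r r' : R -> X) v w : is_ip r r' v -> is_ip r r' w -> v <= w.
Proof.
  intros [Hv _] [_ Hw]. apply le_epsilon. intros eps He.
  destruct (Hw eps He) as (s & Hs & G). specialize (G s s ltac:(lra) ltac:(lra)).
  specialize (Hv s s ltac:(lra) ltac:(lra)).
  apply Rmult_le_reg_l with (s * s); [nra | lra].
Qed.

Lemma is_ip_sym (r r' : R -> X) v : is_ip r r' v -> is_ip r' r v.
Proof.
  intros [H1 H2]. split.
  - intros s t Hs Ht. rewrite hinge_sym, (Rmult_comm s). auto.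
  - intros eps He. destruct (H2 eps He) as (s0 & Hs0 & G). exists s0. split; [exact Hs0 |].
    intros s t Hs Ht. rewrite hinge_sym, (Rmult_comm s). auto.
Qed.

Lemma ip_sym (r r' : R -> X) : is_ray r -> is_ray r' -> ip r r' = ip r' r.
Proof.
  intros Hr Hr'.
  assert (S : is_ip r r' (ip r' r)) by (apply is_ip_sym; now apply ip_spec).
  assert (S' : is_ip r r' (ip r r')) by now apply ip_spec.
  apply Rle_antisym; now apply (is_ip_le r r').
Qed.

Lemma ip_self (r : R -> X) : is_ray r -> ip r r = hip (r 1) (r 1).
Proof.
  intros Hr. destruct Hr as [H1 H2] eqn:E. clear E.
  assert (Hi : is_ip r r (hip (r 1) (r 1))).
  { split.
    - intros s t Hs Ht. rewrite (H2 s t) by lra. lra.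
    - intros eps He. exists 1. split; [lra |]. intros s t Hs Ht. rewrite (H2 s t) by lra.
      apply Rmult_le_compat_l; [apply Rmult_le_pos |]; lra. }
  apply Rle_antisym; eapply is_ip_le; eauto using ip_spec.
Qed.

Lemma ip_near (r r' : R -> X) w w' eps : is_ray r -> is_ray r' -> 0 < w -> 0 < w' ->
  0 < eps -> near0 (fun t => hip (r (w * t)) (r' (w' * t)) <= w * w' * (ip r r' + eps) * (t * t)).
Proof.
  intros Hr Hr' Hw Hw' He. destruct (ip_spec r r' Hr Hr') as [_ G].
  destruct (G eps He) as (s0 & Hs0 & G').
  assert (A : near0 (fun t => w * t <= s0)) by (apply near0_le; lra).
  assert (B : near0 (fun t => w' * t <= s0)) by (apply near0_le; lra).
  apply near0_imp with (2 := near0_and _ _ A B). intros t Ht [h h'].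
  specialize (G' (w * t) (w' * t) ltac:(nra) ltac:(nra)). lra.
Qed.

Lemma O2_ray (r : R -> X) w : is_ray r -> 0 < w -> O2 (fun t => n (r (w * t))).
Proof.
  intros Hr Hw.
  apply O2_le with (2 := O2_const (w * w * hip (r 1) (r 1) / 2)).
  assert (A : near0 (fun t => w * t <= 1)) by (apply near0_le; lra).
  apply near0_imp with (2 := A). intros t Ht h.
  assert (E : hip (r (w * t)) (r (w * t)) = w * t * (w * t) * hip (r 1) (r 1))
    by (apply Hr; nra).
  rewrite hinge_self in E. pose proof (cbb_ge0 e F HF (r (w * t)) p). nra.
Qed.

Lemma O2_rays (r r' : R -> X) w w' : is_ray r -> is_ray r' -> 0 < w -> 0 < w' ->
  O2 (fun t => F (r (w * t)) (r' (w' * t))).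
Proof.
  intros Hr Hr' Hw Hw'.
  assert (P := O2_plus _ _ (O2_plus _ _ (O2_ray r w Hr Hw) (O2_ray r' w' Hr' Hw'))
    (O2_plus _ _ (O2_scal e _ e_ge0 (o2_O2 _ (o2_mult _ _
       (fun t => cbb_ge0 e F HF (r (w * t)) p) (fun t => cbb_ge0 e F HF (r' (w' * t)) p)
       (O2_ray r w Hr Hw) (O2_ray r' w' Hr' Hw'))))
       (O2_const (- (w * w' * ip r r'))))).
  apply O2_le with (2 := P).
  assert (A : near0 (fun t => w * t <= 1)) by (apply near0_le; lra).
  assert (B : near0 (fun t => w' * t <= 1)) by (apply near0_le; lra).
  apply near0_imp with (2 := near0_and _ _ A B). intros t Ht [h h'].
  assert (E := ip_le r r' (w * t) (w' * t) Hr Hr' ltac:(nra) ltac:(nra)).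
  unfold hinge in E. cbv beta. lra.
Qed.

(** * Sums of two tangent vectors, by midpoints *)

Section Sum.
Context (a b : R -> X) (al be : R) (mid : X -> X -> X).
Hypotheses (Ha : is_ray a) (Hb : is_ray b) (al_gt0 : 0 < al) (be_gt0 : 0 < be).
Hypothesis mid_half : forall x y, F x (mid x y) <= F x y / 4.
Hypothesis mid_concave : forall x y z,
  (F z x + F z y) / 2 - F x y / 4 * (1 + e * ((F z x + F z y) / 2)) <= F z (mid x y).

Let x (t : R) := a (al * t).
Let x2 (t : R) := a (2 * al * t).
Let y (t : R) := b (be * t).
Let m (t : R) := mid (x t) (y t).

Let F0 u v : 0 <= F u v := cbb_ge0 e F HF u v.

(* Since [x] is nearly the midpoint of [p] and [x2], comparison at [x] bounds [F m p] from
   above, whereas comparison at the midpoint [m] would only bound it from below. *)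
Lemma midpoint_norm_bound eps : 0 < eps -> near0 (fun t =>
  n (m t) <= (n (x t) + n (y t)) / 2 - F (x t) (y t) / 4
    + (e * (n (x t) * n (x t)) + e * (n (x t) * n (y t)) + al * be * eps * (t * t)
       + e * (n (m t) * n (x2 t))
       + e / 8 * (F (x t) (y t) * (F (x2 t) (x t) + F (x2 t) (y t))))).
Proof.
  intros He.
  assert (A : near0 (fun t => 2 * al * t <= 1)) by (apply near0_le; lra).
  assert (B : near0 (fun t => be * t <= 1)) by (apply near0_le; lra).
  assert (C := ip_near a b (2 * al) be eps Ha Hb ltac:(lra) be_gt0 He).
  apply near0_imp with (2 := near0_and _ _ (near0_and _ _ A B) C). intros t Ht [[hA hB] hC].
  fold (x2 t) (y t) in hC.
  assert (hR : 2 * al * t * hip (x t) (m t) <= al * t * hip (x2 t) (m t)) by (apply Ha; nra).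
  assert (hR' : 2 * hip (x t) (m t) <= hip (x2 t) (m t))
    by (apply Rmult_le_reg_l with (al * t); nra).
  assert (hxx : hip (x t) (x t) = al * t * (al * t) * hip (a 1) (a 1)) by (apply Ha; nra).
  assert (hx2x : hip (x2 t) (x t) = 2 * al * t * (al * t) * hip (a 1) (a 1)) by (apply Ha; nra).
  assert (hxy : al * t * (be * t) * ip a b <= hip (x t) (y t))
    by (apply (ip_le a b (al * t) (be * t) Ha Hb); nra).
  assert (h1 := mid_half (x t) (y t)). fold (m t) in h1.
  assert (h2 := mid_concave (x t) (y t) (x2 t)). fold (m t) in h2.
  rewrite hinge_self in hxx. set (N := hip (a 1) (a 1)) in *. unfold hinge in hR', hx2x, hxy, hC.
  assert (E : forall u v, 0 <= e * n u * n v)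
    by (intros; apply Rmult_le_pos; [apply Rmult_le_pos |]; auto).
  pose proof (E (x t) (m t)). pose proof (E (x2 t) (x t)). pose proof (E (x2 t) (y t)).
  lra.
Qed.

(** [midpoint_norm_bound] has [n (m t)] on both sides. On the right it carries the factor
    [e * n (x2 t)], at most [1 / 2] for small [t], and is absorbed on the left; hence the factor [2]
    in [P]. Only after this crude bound can [n (m t)] be fed to [o2_mult]. *)
Lemma O2_midpoint_norm : O2 (fun t => n (m t)).
Proof.
  assert (Nx := O2_ray a al Ha al_gt0). assert (Ny := O2_ray b be Hb be_gt0).
  assert (Nx2 := O2_ray a (2 * al) Ha ltac:(lra)).
  assert (Fxy := O2_rays a b al be Ha Hb al_gt0 be_gt0).
  assert (Fx2x := O2_rays a a (2 * al) al Ha Ha ltac:(lra) al_gt0).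
  assert (Fx2y := O2_rays a b (2 * al) be Ha Hb ltac:(lra) be_gt0).
  assert (P : O2 (fun t => 2 * ((1 / 2) * (n (x t) + n (y t)) +
    ((e * (n (x t) * n (x t)) + e * (n (x t) * n (y t))) + (al * be * 1 * (t * t)
       + e / 8 * (F (x t) (y t) * (F (x2 t) (x t) + F (x2 t) (y t)))))))).
  { apply O2_scal; [lra |]. apply O2_plus; [apply O2_scal; [lra |]; now apply O2_plus |].
    apply O2_plus; apply O2_plus.
    - apply O2_scal; [lra |]. apply o2_O2, o2_mult; auto.
    - apply O2_scal; [lra |]. apply o2_O2, o2_mult; auto.
    - apply O2_const.
    - apply O2_scal; [lra |]. apply o2_O2, o2_mult; auto.
      + intros t. apply Rplus_le_le_0_compat; auto.
      + now apply O2_plus. }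
  apply O2_le with (2 := P).
  destruct Nx2 as (C & HC & Nx2).
  assert (D : near0 (fun t => 2 * e * C * t <= 1)) by (apply near0_le; lra).
  assert (D1 : near0 (fun t => 1 * t <= 1)) by (apply near0_le; lra).
  apply near0_imp with (2 := near0_and _ _ (midpoint_norm_bound 1 Rlt_0_1)
    (near0_and _ _ Nx2 (near0_and _ _ D D1))).
  intros t Ht (h & h1 & h2 & h3). cbv beta in *. fold (x2 t) in h1.
  assert (h4 : 2 * e * n (x2 t) <= 1).
  { apply Rle_trans with (2 * e * (C * (t * t))); [apply Rmult_le_compat_l; lra |].
    assert (0 <= 2 * e * C * t) by (apply Rmult_le_pos; [apply Rmult_le_pos |]; lra). nra. }
  assert (h5 : n (m t) * (2 * e * n (x2 t)) <= n (m t) * 1)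
    by (apply Rmult_le_compat_l; auto).
  pose proof (F0 (x t) (y t)). lra.
Qed.

Lemma o2_midpoint_norm :
  o2 (fun t => n (m t) - (n (x t) + n (y t)) / 2 + F (x t) (y t) / 4).
Proof.
  assert (Nm := O2_midpoint_norm).
  assert (Nx := O2_ray a al Ha al_gt0). assert (Ny := O2_ray b be Hb be_gt0).
  assert (Nx2 := O2_ray a (2 * al) Ha ltac:(lra)).
  assert (Fxy := O2_rays a b al be Ha Hb al_gt0 be_gt0).
  assert (Fx2x := O2_rays a a (2 * al) al Ha Ha ltac:(lra) al_gt0).
  assert (Fx2y := O2_rays a b (2 * al) be Ha Hb ltac:(lra) be_gt0).
  assert (P : o2 (fun t => (e * (n (x t) * n (x t)) + e * (n (x t) * n (y t)))
       + (e * (n (m t) * n (x2 t))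
       + e / 8 * (F (x t) (y t) * (F (x2 t) (x t) + F (x2 t) (y t)))))).
  { apply o2_plus; apply o2_plus; apply o2_scal; try lra; apply o2_mult; auto.
    - intros t. apply Rplus_le_le_0_compat; auto.
    - now apply O2_plus. }
  intros eps He.
  assert (He1 : 0 < eps / 2 / (al * be)) by (apply Rdiv_lt_0_compat; nra).
  apply near0_imp with (2 := near0_and _ _ (midpoint_norm_bound _ He1) (P (eps / 2) ltac:(lra))).
  intros t Ht [h1 h2]. cbv beta in *.
  replace (al * be * (eps / 2 / (al * be))) with (eps / 2) in h1 by (field; lra).
  lra.
Qed.

(** Twice the median from [p] is the sum of the two sides: by [o2_midpoint_norm], [8 n (m)] is at
    most [4 n (x) + 4 n (y) - 2 F (x, y)] to second order, and this is
    [hip x x + hip y y + 2 hip x y] up to products of costs. *)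
Lemma sum_norm eta : 0 < eta -> near0 (fun t =>
  4 * hip (m t) (m t) <=
    (al * al * ip a a + be * be * ip b b + 2 * (al * be * ip a b) + eta) * (t * t)).
Proof.
  intros He.
  assert (Nm := O2_midpoint_norm).
  assert (P : o2 (fun t => 8 * (n (m t) - (n (x t) + n (y t)) / 2 + F (x t) (y t) / 4)
    + 4 * e * (n (m t) * n (m t)))).
  { apply o2_plus; apply o2_scal; try lra; [apply o2_midpoint_norm | apply o2_mult; auto]. }
  assert (He1 : 0 < eta / 4 / (al * be)) by (apply Rdiv_lt_0_compat; nra).
  assert (A : near0 (fun t => al * t <= 1)) by (apply near0_le; lra).
  assert (B : near0 (fun t => be * t <= 1)) by (apply near0_le; lra).
  apply near0_imp with (2 := near0_and _ _ (near0_and _ _ A B) (near0_and _ _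
    (P (eta / 2) ltac:(lra)) (ip_near a b al be _ Ha Hb al_gt0 be_gt0 He1))).
  intros t Ht ([hA hB] & h1 & h2). cbv beta in *. fold (x t) (y t) in h2.
  assert (hx : hip (x t) (x t) = al * t * (al * t) * hip (a 1) (a 1)) by (apply Ha; nra).
  assert (hy : hip (y t) (y t) = be * t * (be * t) * hip (b 1) (b 1)) by (apply Hb; nra).
  rewrite <- (ip_self a Ha) in hx. rewrite <- (ip_self b Hb) in hy.
  rewrite hinge_self in hx, hy |- *. unfold hinge in h2.
  assert (E : al * be * (ip a b + eta / 4 / (al * be)) = al * be * ip a b + eta / 4)
    by (field; lra).
  rewrite E in h2.
  assert (E' : forall u v, 0 <= e * n u * n v)
    by (intros; apply Rmult_le_pos; [apply Rmult_le_pos |]; auto).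
  pose proof (E' (x t) (x t)). pose proof (E' (y t) (y t)). pose proof (E' (x t) (y t)).
  lra.
Qed.

(** Comparison at the midpoint, seen from [j t], bounds its hinge with [j t] by the mean of the
    hinges of [x t] and [y t]: the loss [F (x, y) / 4] cancels against the one in
    [o2_midpoint_norm]. One of the two factors [t] is then divided out. The ray [c] depends on [t],
    so it is quantified inside [near0]. *)
Lemma sum_ip (j : R -> X) eta : is_ray j -> 0 < eta -> near0 (fun t => forall c,
  is_ray c -> c 1 = m t -> 2 * ip c j <= (al * ip a j + be * ip b j + eta) * t).
Proof.
  intros Hj He.
  assert (Nm := O2_midpoint_norm). assert (Nz := O2_ray j 1 Hj Rlt_0_1).
  assert (Fxy := O2_rays a b al be Ha Hb al_gt0 be_gt0).
  assert (Fxz := O2_rays a j al 1 Ha Hj al_gt0 Rlt_0_1).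
  assert (Fyz := O2_rays b j be 1 Hb Hj be_gt0 Rlt_0_1).
  set (z := fun t => j (1 * t)).
  assert (P : o2 (fun t => 2 * (n (m t) - (n (x t) + n (y t)) / 2 + F (x t) (y t) / 4)
    + (2 * e * (n (m t) * n (z t)) + e / 4 * (F (x t) (y t) * (F (x t) (z t) + F (y t) (z t)))))).
  { apply o2_plus; [| apply o2_plus]; apply o2_scal; try lra;
      [apply o2_midpoint_norm | apply o2_mult; auto | apply o2_mult; auto].
    - intros t. apply Rplus_le_le_0_compat; auto.
    - now apply O2_plus. }
  assert (Hea : 0 < eta / 4 / al) by (repeat apply Rdiv_lt_0_compat; lra).
  assert (Heb : 0 < eta / 4 / be) by (repeat apply Rdiv_lt_0_compat; lra).
  assert (A : near0 (fun t => 1 * t <= 1)) by (apply near0_le; lra).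
  apply near0_imp with (2 := near0_and _ _ A (near0_and _ _ (P (eta / 2) ltac:(lra)) (near0_and _ _
    (ip_near a j al 1 _ Ha Hj al_gt0 Rlt_0_1 Hea) (ip_near b j be 1 _ Hb Hj be_gt0 Rlt_0_1 Heb)))).
  intros t Ht (hA & h1 & h2 & h3) c Hc Ec. cbv beta in *.
  fold (x t) (z t) in h2. fold (y t) (z t) in h3.
  assert (h4 : 1 * (1 * t) * ip c j <= hip (c 1) (z t))
    by (apply (ip_le c j 1 (1 * t) Hc Hj); lra).
  rewrite Ec in h4.
  assert (h5 := mid_concave (x t) (y t) (z t)). fold (m t) in h5.
  rewrite (cbb_sym e F HF (z t) (m t)), (cbb_sym e F HF (z t) (x t)),
    (cbb_sym e F HF (z t) (y t)) in h5.
  unfold hinge in h2, h3, h4.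
  replace (al * 1 * (ip a j + eta / 4 / al)) with (al * ip a j + eta / 4) in h2 by (field; lra).
  replace (be * 1 * (ip b j + eta / 4 / be)) with (be * ip b j + eta / 4) in h3 by (field; lra).
  assert (E : forall u v, 0 <= e * n u * n v)
    by (intros; apply Rmult_le_pos; [apply Rmult_le_pos |]; auto).
  pose proof (E (x t) (z t)). pose proof (E (y t) (z t)).
  apply Rmult_le_reg_l with t; [lra |]. lra.
Qed.

End Sum.

(** Induction on the number of rays. The vectors [al a] and [be b] are replaced by one which is, up
    to [eta], no longer than their sum and has no larger product with any other ray. The Gram sum
    thus exceeds that of a shorter list, up to [eps]. Zero weights are dropped first, as the
    midpoint construction needs positive ones. *)
Lemma ip_dsum_ge0 (l : list (R * (R -> X))) :
  (forall i, In i l -> 0 <= fst i /\ is_ray (snd i)) ->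
  0 <= dsum (fun i j => fst i * fst j * ip (snd i) (snd j)) l.
Proof.
  set (g := fun i j : R * (R -> X) => fst i * fst j * ip (snd i) (snd j)).
  assert (gsym : forall i j, is_ray (snd i) -> is_ray (snd j) -> g i j = g j i).
  { intros i j Hi Hj. unfold g. rewrite (ip_sym (snd i) (snd j) Hi Hj). ring. }
  remember (length l) as k eqn:Ek. revert l Ek.
  induction k as [| k IH]; intros l Ek Hl.
  { destruct l; [| discriminate]. unfold dsum. simpl. lra. }
  destruct l as [| [al a] l]; [discriminate |].
  injection Ek as Ek.
  assert (Hl' : forall i, In i l -> 0 <= fst i /\ is_ray (snd i))
    by (intros; apply Hl; now right).
  destruct (Hl (al, a) (or_introl eq_refl)) as [[al_gt0 | al_0] Ha]; simpl fst in *; simpl snd in *.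
  2:{ rewrite dsum_cons by (intros j Hj; apply gsym; [apply Hl', Hj | exact Ha]).
      rewrite (lsum_ext _ (fun _ => 0 * 0)), lsum_scal
        by (intros j Hj; unfold g; simpl; rewrite <- al_0; ring).
      unfold g at 1. simpl. rewrite <- al_0. specialize (IH l Ek Hl'). lra. }
  destruct l as [| [be b] l].
  { unfold dsum. simpl. unfold g. simpl. rewrite (ip_self a Ha), hinge_self.
    pose proof (cbb_ge0 e F HF (a 1) p) as h.
    assert (0 <= 2 * F (a 1) p + e * F (a 1) p * F (a 1) p)
      by (assert (0 <= e * F (a 1) p * F (a 1) p)
            by (apply Rmult_le_pos; [apply Rmult_le_pos |]; lra); lra).
    assert (0 <= al * al * (2 * F (a 1) p + e * F (a 1) p * F (a 1) p))
      by (apply Rmult_le_pos; [apply Rle_0_sqr | assumption]).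
    lra. }
  simpl in Ek.
  assert (Hl2 : forall i, In i l -> 0 <= fst i /\ is_ray (snd i))
    by (intros; apply Hl'; now right).
  destruct (Hl' (be, b) (or_introl eq_refl)) as [[be_gt0 | be_0] Hb]; simpl fst in *; simpl snd in *.
  2:{ assert (IH' := IH ((al, a) :: l) ltac:(simpl; lia)
        ltac:(intros i [<- | Hi]; [split; simpl; [lra | exact Ha] | auto])).
      rewrite dsum_cons in IH' |- * by (intros j Hj; apply gsym; [| exact Ha];
        first [apply Hl2, Hj | apply Hl', Hj]).
      rewrite dsum_cons by (intros j Hj; apply gsym; [apply Hl2, Hj | exact Hb]).
      simpl lsum. rewrite (lsum_ext (g (be, b)) (fun _ => 0 * 0)), lsum_scal
        by (intros j Hj; unfold g; simpl; rewrite <- be_0; ring).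
      assert (E1 : g (al, a) (be, b) = 0) by (unfold g; simpl; rewrite <- be_0; ring).
      assert (E2 : g (be, b) (be, b) = 0) by (unfold g; simpl; rewrite <- be_0; ring).
      rewrite E1, E2. lra. }
  destruct (choice (fun (q : X * X) w => F (fst q) w <= F (fst q) (snd q) / 4 /\
    forall z, (F z (fst q) + F z (snd q)) / 2
      - F (fst q) (snd q) / 4 * (1 + e * ((F z (fst q) + F z (snd q)) / 2)) <= F z w))
    as [mid0 Hmid].
  { intros [u v]. apply (cbb_mid e F HF). }
  set (mid := fun u v => mid0 (u, v)).
  assert (mid_half : forall u v, F u (mid u v) <= F u v / 4)
    by (intros u v; apply (Hmid (u, v))).
  assert (mid_concave : forall u v z,
    (F z u + F z v) / 2 - F u v / 4 * (1 + e * ((F z u + F z v) / 2)) <= F z (mid u v))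
    by (intros u v z; apply (Hmid (u, v))).
  apply le_epsilon. intros eps He.
  set (W := lsum (fun i => fst i) l).
  assert (HW : 0 <= W) by (apply lsum_ge0; intros i Hi; now apply Hl2).
  (* One [eta] is lost in the square of the new vector, and [eta * fst i] in its product with each
     remaining ray, which is counted twice. *)
  set (eta := eps / (1 + 2 * W)).
  assert (Heta : 0 < eta) by (apply Rdiv_lt_0_compat; lra).
  assert (N1 := sum_norm a b al be mid Ha Hb al_gt0 be_gt0 mid_half mid_concave eta Heta).
  assert (N2 := near0_list _ l (fun i Hi => sum_ip a b al be mid Ha Hb al_gt0 be_gt0
    mid_half mid_concave (snd i) eta (proj2 (Hl2 i Hi)) Heta)).
  destruct (near0_ex _ (near0_and _ _ N1 N2)) as (t & Ht & h1 & h2). clear N1 N2.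
  destruct (ray_through (mid (a (al * t)) (b (be * t)))) as (c & Ec & Hc).
  (* The midpoint halves the sum and the factor [t] shrinks it; [2 / t] undoes both. *)
  set (ga := 2 / t).
  assert (Hga : 0 < ga) by (apply Rdiv_lt_0_compat; lra).
  assert (IH' := IH ((ga, c) :: l) ltac:(simpl; lia)
    ltac:(intros i [<- | Hi]; [split; simpl; [lra | exact Hc] | auto])).
  rewrite dsum_cons in IH' by (intros j Hj; apply gsym; [apply Hl2, Hj | exact Hc]).
  rewrite dsum_cons by (intros j Hj; apply gsym; [apply Hl', Hj | exact Ha]).
  rewrite dsum_cons by (intros j Hj; apply gsym; [apply Hl2, Hj | exact Hb]).
  simpl lsum.
  assert (G1 : g (ga, c) (ga, c) <=
    g (al, a) (al, a) + g (be, b) (be, b) + 2 * g (al, a) (be, b) + eta).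
  { unfold g. simpl. rewrite (ip_self c Hc), Ec.
    apply Rmult_le_reg_r with (t * t); [nra |].
    replace (ga * ga * _ * (t * t)) with (4 * hip (mid (a (al * t)) (b (be * t)))
      (mid (a (al * t)) (b (be * t)))) by (unfold ga; field; lra).
    lra. }
  assert (G2 : lsum (g (ga, c)) l <= lsum (g (al, a)) l + lsum (g (be, b)) l + eta * W).
  { unfold W. rewrite <- lsum_scal, <- !lsum_plus. apply lsum_le. intros i Hi.
    specialize (h2 i Hi c Hc Ec). unfold g. simpl.
    assert (h3 : ga * ip c (snd i) <= al * ip a (snd i) + be * ip b (snd i) + eta).
    { apply Rmult_le_reg_r with t; [lra |].
      replace (ga * ip c (snd i) * t) with (2 * ip c (snd i)) by (unfold ga; field; lra).
      exact h2. }
    destruct (Hl2 i Hi) as [Hi0 _].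
    apply Rmult_le_compat_l with (r := fst i) in h3; lra. }
  assert (E : eta * (1 + 2 * W) = eps) by (unfold eta; field; lra).
  lra.
Qed.

(* Lang-Schroeder-Sturm inequality *)
Lemma hinge_dsum_ge0 {I : Type} (mu : I -> R) (x : I -> X) (l : list I) :
  (forall i, In i l -> 0 <= mu i) ->
  0 <= dsum (fun i j => mu i * mu j * hip (x i) (x j)) l.
Proof.
  intros Hmu. destruct (choice _ ray_through) as [ray Hray].
  assert (P := ip_dsum_ge0 (map (fun i => (mu i, ray (x i))) l)).
  unfold dsum in *. rewrite lsum_map in P.
  apply Rle_trans with (1 := P ltac:(intros i Hi; apply in_map_iff in Hi;
    destruct Hi as (j & <- & Hj); split; [now apply Hmu | apply Hray])).
  apply lsum_le. intros i Hi. rewrite lsum_map. apply lsum_le. intros j Hj. simpl.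
  apply Rmult_le_compat_l; [apply Rmult_le_pos; auto |].
  destruct (Hray (x i)) as [Ei Ri], (Hray (x j)) as [Ej Rj].
  pose proof (ip_le (ray (x i)) (ray (x j)) 1 1 Ri Rj ltac:(lra) ltac:(lra)) as G.
  rewrite Ei, Ej in G. lra.
Qed.

End TangentCone.

(** * Kirszbraun's theorem *)

Lemma lsum_ge_term {I : Type} (g : I -> R) (l : list I) (i : I) :
  (forall j, In j l -> 0 <= g j) -> In i l -> g i <= lsum g l.
Proof.
  induction l as [| k l IH]; intros H Hi; [destruct Hi |]. simpl.
  assert (Hl : forall j, In j l -> 0 <= g j) by (intros; apply H; now right).
  destruct Hi as [-> | Hi].
  - pose proof (lsum_ge0 g l Hl). lra.
  - pose proof (IH Hl Hi). pose proof (H k (or_introl eq_refl)). lra.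
Qed.

Lemma dsum_hinge {I X : Type} (e : R) (F : X -> X -> R) (p : X) (mu : I -> R)
    (x : I -> X) (l : list I) :
  dsum (fun i j => mu i * mu j * hinge e F p (x i) (x j)) l =
    2 * lsum mu l * lsum (fun i => mu i * F (x i) p) l
    + e * lsum (fun i => mu i * F (x i) p) l * lsum (fun i => mu i * F (x i) p) l
    - dsum (fun i j => mu i * mu j * F (x i) (x j)) l.
Proof.
  set (M := lsum mu l). set (S := lsum (fun i => mu i * F (x i) p) l).
  unfold dsum.
  rewrite (lsum_ext _ (fun i => (M * (mu i * F (x i) p) + S * mu i)
    + (e * S * (mu i * F (x i) p) + (-1) * lsum (fun j => mu i * mu j * F (x i) (x j)) l))).
  - rewrite !lsum_plus, !lsum_scal. fold M S. ring.
  - intros i _. rewrite (lsum_ext _ (fun j => (mu i * F (x i) p * mu j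
      + mu i * (mu j * F (x j) p)) + (e * (mu i * F (x i) p) * (mu j * F (x j) p)
      + (-1) * (mu i * mu j * F (x i) (x j))))) by (intros; unfold hinge; ring).
    rewrite !lsum_plus, !lsum_scal. fold M S. ring.
Qed.

Lemma list_upper_bound {I : Type} (g : I -> R) (l : list I) :
  exists B, forall i, In i l -> g i <= B.
Proof.
  exists (lsum (fun i => Rabs (g i)) l). intros i Hi.
  apply Rle_trans with (1 := Rle_abs (g i)).
  apply (lsum_ge_term (fun i => Rabs (g i))); [intros; apply Rabs_pos | exact Hi].
Qed.

Lemma infimum_exists {T : Type} (J : T -> R) :
  inhabited T -> (forall q, 0 <= J q) ->
  exists j, (forall q, j <= J q) /\ forall eta, 0 < eta -> exists q, J q < j + eta.
Proof.
  intros [q0] HJ. destruct (completeness (fun v => exists q, v = - J q)) as [v [H1 H2]].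
  - exists 0. intros v [q ->]. specialize (HJ q). lra.
  - exists (- J q0), q0. reflexivity.
  - exists (- v). split.
    + intros q. assert (- J q <= v) by (apply H1; now exists q). lra.
    + intros eta He. apply NNPP. intros N. assert (v <= v - eta); [| lra].
      apply H2. intros w [q ->]. destruct (Rlt_dec (J q) (- v + eta)); [| lra].
      exfalso. apply N. now exists q.
Qed.

Lemma Rmax0_sqr_le (r a d : R) : r <= a + d ->
  Rmax r 0 * Rmax r 0 <= (Rmax a 0 + d) * (Rmax a 0 + d).
Proof.
  intros H. pose proof (Rmax_l a 0). pose proof (Rmax_r a 0).
  unfold Rmax at 1 2. destruct (Rle_dec r 0).
  - rewrite Rmult_0_r. apply Rle_0_sqr.
  - nra.
Qed.

(** * The one-point extension problem in a CAT space *)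

Section OnePoint.
Context (e : R) (Y : MetricSpace) (F : Y -> Y -> R).
Hypothesis e_ge0 : 0 <= e.
Hypothesis HF : cat_kernel e Y F.

(* Near a minimiser [q] of the sum of the squared positive parts of [F q (y i) - c i],
   that positive part serves as the weight [m i] which makes [q] nearly a barycentre. *)
Lemma finite_one_point {I : Type} (y : I -> Y) (c : I -> R) (l : list I) :
  inhabited Y -> (forall i, In i l -> 0 <= c i) ->
  (forall mu, (forall i, In i l -> 0 <= mu i) ->
     dsum (fun i j => mu i * mu j * F (y i) (y j)) l <=
       2 * lsum mu l * lsum (fun i => mu i * c i) l
       + e * lsum (fun i => mu i * c i) l * lsum (fun i => mu i * c i) l) ->
  forall eps, 0 < eps -> exists q, forall i, In i l -> F q (y i) <= c i + eps.
Proof.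
  intros Y0 Hc HLS eps He.
  pose (m := fun q i => Rmax (F q (y i) - c i) 0).
  pose (J := fun q => lsum (fun i => m q i * m q i) l).
  assert (m_ge0 : forall q i, 0 <= m q i) by (intros; apply Rmax_r).
  assert (m_ge : forall q i, F q (y i) - c i <= m q i) by (intros; apply Rmax_l).
  assert (mm_ge0 : forall q i, 0 <= m q i * m q i) by (intros; apply Rle_0_sqr).
  assert (F_ge0 := cat_ge0 e Y F HF).
  assert (J_ge : forall q i, In i l -> m q i * m q i <= J q)
    by (intros q i Hi; apply (lsum_ge_term (fun i => m q i * m q i)); auto).
  destruct (infimum_exists J Y0) as (j & Hj1 & Hj2); [intros; apply lsum_ge0; auto |].
  destruct (Rle_dec j 0) as [j_le0 | j_gt0].
  { destruct (Hj2 (eps * eps) ltac:(nra)) as [q Hq]. exists q. intros i Hi.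
    specialize (J_ge q i Hi). specialize (m_ge q i). specialize (m_ge0 q i).
    assert (m q i <= eps) by nra. lra. }
  exfalso. apply Rnot_le_lt in j_gt0.
  destruct (list_upper_bound c l) as [B1 HB1].
  destruct (list_upper_bound (fun ij => F (y (fst ij)) (y (snd ij))) (list_prod l l))
    as [B2 HB2].
  set (B := Rabs B1 + Rabs B2 + j + 2).
  pose proof (Rabs_pos B1). pose proof (Rabs_pos B2).
  pose proof (Rle_abs B1). pose proof (Rle_abs B2).
  assert (B_gt0 : 0 < B) by (unfold B; lra).
  assert (HBy : forall i i', In i l -> In i' l -> F (y i) (y i') <= B).
  { intros i i' Hi Hi'. pose proof (HB2 (i, i') (in_prod l l i i' Hi Hi')) as h.
    simpl in h. unfold B. lra. }
  assert (HBm : forall q i, J q < j + 1 -> In i l -> m q i <= B /\ F q (y i) <= B).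
  { intros q i Hq Hi. specialize (J_ge q i Hi). specialize (m_ge q i).
    specialize (HB1 i Hi). assert (m q i <= j + 1) by nra. unfold B. split; lra. }
  (* [K1] bounds the second-order coefficient of [cat_first_order], and [K] the whole increment
     divided by [t]. [K2] collects the terms of order [t^2] in the variation of [J], with [1] for
     the excess [t * t] of [J q] over the infimum. *)
  set (K1 := B * (2 + B) * (1 + e * B)).
  assert (eB : 0 <= e * B) by nra.
  assert (K1_ge0 : 0 <= K1) by (unfold K1; apply Rmult_le_pos; [nra | lra]).
  set (K := 2 * B + B * (1 + e * B) + K1).
  assert (K_ge0 : 0 <= K) by (unfold K; nra).
  set (N := lsum (fun _ : I => 1) l).
  assert (N_ge0 : 0 <= N) by (apply lsum_ge0; intros; lra).
  set (K2 := 1 + N * (2 * B * K1 + K * K)).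
  assert (K2_ge0 : 1 <= K2).
  { unfold K2. assert (0 <= N * (2 * B * K1 + K * K)) by (apply Rmult_le_pos; nra). lra. }
  set (t := Rmin 1 (j / K2)).
  assert (t_gt0 : 0 < t) by (apply Rmin_glb_lt; [lra | apply Rdiv_lt_0_compat; lra]).
  assert (t_le1 : t <= 1) by apply Rmin_l.
  assert (tK2 : t * K2 <= j).
  { apply Rle_trans with (j / K2 * K2); [apply Rmult_le_compat_r; [lra | apply Rmin_r] |].
    right. field. lra. }
  destruct (Hj2 (t * t) ltac:(nra)) as [q Hq].
  assert (Hq1 : J q < j + 1) by nra.
  (* Moving [q] by [t] towards [y o] changes [J] by at most [- 2 t] times the weighted sum of hinges
     plus order [t^2]. As [q] is within [t * t] of the infimum, that sum is at most of order [t]. *)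
  assert (Var : forall o, In o l ->
    2 * lsum (fun i => m q i * hinge e F q (y o) (y i)) l <= t * K2).
  { intros o Ho. destruct (cat_first_order e Y F HF q (y o) t ltac:(lra)) as [w Hw].
    assert (JW : J w <= J q + (2 * t * (-1)) * lsum (fun i => m q i * hinge e F q (y o) (y i)) l
      + t * t * (2 * B * K1 + K * K) * N).
    { unfold J, N. rewrite <- !lsum_scal, <- !lsum_plus. apply lsum_le. intros i Hi.
      specialize (Hw (y i)). destruct (HBm q i Hq1 Hi) as [Bm Bq].
      destruct (HBm q o Hq1 Ho) as [_ Bo]. pose proof (HBy o i Ho Hi) as Boi.
      pose proof (F_ge0 q (y i)) as P1. pose proof (F_ge0 q (y o)) as P2.
      pose proof (F_ge0 (y o) (y i)) as P3. specialize (m_ge0 q i).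
      unfold hinge. rewrite (cat_sym e Y F HF (y o) q), (cat_sym e Y F HF (y i) q).
      set (a := F q (y i)) in *. set (b := F q (y o)) in *. set (d := F (y o) (y i)) in *.
      assert (eab : e * a <= e * B) by (apply Rmult_le_compat_l; lra).
      assert (ea0 : 0 <= e * a) by (apply Rmult_le_pos; lra).
      assert (Q1 : b * (2 + b) <= B * (2 + B)) by (apply Rmult_le_compat; lra).
      assert (Q0 : 0 <= b * (2 + b)) by (apply Rmult_le_pos; lra).
      assert (Q2 : b * (2 + b) * (1 + e * a) <= K1)
        by (unfold K1; apply Rmult_le_compat; lra).
      assert (Q3 : 0 <= b * (2 + b) * (1 + e * a)) by (apply Rmult_le_pos; lra).
      assert (Q4 : b * (1 + e * a) <= B * (1 + e * B)) by (apply Rmult_le_compat; lra).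
      assert (Q5 : 0 <= b * (1 + e * a)) by (apply Rmult_le_pos; lra).
      set (D0 := d - a - b * (1 + e * a)) in *.
      set (E0 := b * (2 + b) * (1 + e * a)) in *.
      assert (tE : 0 <= t * E0 <= K1) by nra.
      set (D := D0 + t * E0).
      assert (HD : - K <= D <= K) by (unfold D, D0, K; lra).
      assert (HDD : D * D <= K * K) by nra.
      assert (S := Rmax0_sqr_le (F w (y i) - c i) (a - c i) (t * D)).
      assert (Hle : F w (y i) - c i <= a - c i + t * D) by (unfold D; lra).
      specialize (S Hle). change (Rmax (a - c i) 0) with (m q i) in S.
      change (Rmax (F w (y i) - c i) 0) with (m w i) in S.
      assert (mE : m q i * E0 <= B * K1) by (apply Rmult_le_compat; lra).
      assert (T1 : t * t * (m q i * E0) <= t * t * (B * K1))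
        by (apply Rmult_le_compat_l; [nra | exact mE]).
      assert (T2 : t * t * (D * D) <= t * t * (K * K))
        by (apply Rmult_le_compat_l; [nra | exact HDD]).
      replace (a + b) with (b + a) by ring.
      replace ((m q i + t * D) * (m q i + t * D)) with
        (m q i * m q i + 2 * t * (m q i * D0) + 2 * (t * t * (m q i * E0)) + t * t * (D * D))
        in S by (unfold D; ring).
      unfold D0 in S. lra. }
    specialize (Hj1 w). unfold K2.
    apply Rmult_le_reg_l with t; [exact t_gt0 |]. lra. }
  set (M := lsum (m q) l).
  assert (M_ge0 : 0 <= M) by (apply lsum_ge0; auto).
  assert (JM : J q <= B * M).
  { unfold J, M. rewrite <- lsum_scal. apply lsum_le. intros i Hi.
    apply Rmult_le_compat_r; [apply m_ge0 | now apply HBm]. }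
  assert (M_gt0 : 0 < M) by (specialize (Hj1 q); nra).
  assert (S1 : 2 * dsum (fun i k => m q i * m q k * hinge e F q (y i) (y k)) l
    <= t * K2 * M).
  { unfold dsum, M. rewrite <- !lsum_scal. apply lsum_le. intros o Ho.
    rewrite (lsum_ext _ (fun i => m q o * (m q i * hinge e F q (y o) (y i))))
      by (intros; ring).
    rewrite lsum_scal. specialize (Var o Ho). specialize (m_ge0 q o).
    apply Rmult_le_compat_l with (r := m q o) in Var; lra. }
  (* [S1] makes twice the Gram sum of hinges at most [j * M]. But [HLS] bounds the double sum of
     costs by the same expression with [b] for [a], and [a - b = J q >= j], so the Gram sum is at
     least [2 * M * j]: a contradiction. *)
  rewrite dsum_hinge in S1. fold M in S1.
  specialize (HLS (m q) (fun i _ => m_ge0 q i)). fold M in HLS.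
  set (a := lsum (fun i => m q i * F (y i) q) l) in *.
  set (b := lsum (fun i => m q i * c i) l) in *.
  assert (b_ge0 : 0 <= b) by (apply lsum_ge0; intros; apply Rmult_le_pos; auto).
  assert (ab : a - b = J q).
  { replace (a - b) with (a + (-1) * b) by ring. unfold a, b, J.
    rewrite <- lsum_scal, <- lsum_plus. apply lsum_ext. intros i _.
    rewrite (cat_sym e Y F HF (y i) q). unfold m, Rmax.
    destruct (Rle_dec (F q (y i) - c i) 0); ring. }
  specialize (Hj1 q).
  assert (eab : e * b * b <= e * a * a).
  { rewrite !Rmult_assoc. apply Rmult_le_compat_l; [exact e_ge0 | nra]. }
  assert (Mj : M * j <= M * (a - b)) by (apply Rmult_le_compat_l; lra).
  assert (tM : t * K2 * M <= j * M) by (apply Rmult_le_compat_r; lra).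
  assert (0 < M * j) by (apply Rmult_lt_0_compat; lra).
  lra.
Qed.

(** Points taken in members of diameter below [/ INR (S k)] form a Cauchy sequence because any two
    members meet. The members need not be closed, so the limit is only adherent to each of them. *)
Lemma cantor_intersection (D : (Y -> Prop) -> Prop) :
  complete Y ->
  (forall A, D A -> exists q, A q) ->
  (forall A B, D A -> D B -> exists C, D C /\ forall q, C q -> A q /\ B q) ->
  (forall d, 0 < d -> exists A, D A /\ forall q z, A q -> A z -> mdist q z < d) ->
  exists q, forall A, D A -> forall d, 0 < d -> exists q', A q' /\ mdist q q' < d.
Proof.
  intros HY Hne Hdir Hsmall.
  assert (pos : forall k : nat, 0 < / INR (S k)).
  { intros k. apply Rinv_0_lt_compat, lt_0_INR. lia. }
  destruct (choice (fun (k : nat) (A : Y -> Prop) => D A /\ forall q z, A q -> A z ->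
    mdist q z < / INR (S k)) (fun k => Hsmall _ (pos k))) as [A HA].
  destruct (choice (fun (k : nat) q => A k q) (fun k => Hne _ (proj1 (HA k)))) as [u Hu].
  assert (small : forall d, 0 < d -> exists k0, forall k, (k0 <= k)%nat -> / INR (S k) < d).
  { intros d Hd. destruct (archimed_cor1 d Hd) as (k0 & Hk0 & Hk0').
    exists k0. intros k Hk. apply Rle_lt_trans with (2 := Hk0).
    apply Rinv_le_contravar; [now apply lt_0_INR | apply le_INR; lia]. }
  destruct (HY u) as [q Hq].
  { intros d Hd. destruct (small (d / 2) ltac:(lra)) as [k0 Hk0]. exists k0.
    intros k l Hk Hl. destruct (Hdir (A k) (A l)) as (C & HC & HCs); try apply HA.
    destruct (Hne C HC) as [w Hw]. destruct (HCs w Hw) as [w1 w2].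
    pose proof (proj2 (HA k) _ _ (Hu k) w1). pose proof (proj2 (HA l) _ _ w2 (Hu l)).
    pose proof (Hk0 k Hk). pose proof (Hk0 l Hl).
    pose proof (mdist_tri Y (u k) w (u l)). lra. }
  exists q. intros B HB d Hd.
  destruct (small (d / 2) ltac:(lra)) as [k0 Hk0].
  destruct (Hq (d / 2) ltac:(lra)) as [k1 Hk1]. set (k := max k0 k1).
  specialize (Hk0 k ltac:(lia)). specialize (Hk1 k ltac:(lia)).
  destruct (Hdir (A k) B) as (C & HC & HCs); [apply HA | exact HB |].
  destruct (Hne C HC) as [w Hw]. destruct (HCs w Hw) as [w1 w2].
  exists w. split; [exact w2 |].
  pose proof (proj2 (HA k) _ _ (Hu k) w1).
  pose proof (mdist_tri Y q (u k) w) as T. rewrite (mdist_sym Y q (u k)) in T. lra.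
Qed.

(* Weak compactness of bounded closed convex sets. *)
Lemma one_point_compactness {I : Type} (y : I -> Y) (c : I -> R) (i0 : I) :
  complete Y ->
  (forall l eps, 0 < eps -> exists q, forall i, In i l -> F q (y i) <= c i + eps) ->
  exists q, forall i, F q (y i) <= c i.
Proof.
  intros HY Hfin. assert (F_ge0 := cat_ge0 e Y F HF).
  set (C := fun l eps q => forall i, In i l -> F q (y i) <= c i + eps).
  assert (Csub : forall l l' eps eps' q, (forall i, In i l -> In i l') -> eps' <= eps ->
    C l' eps' q -> C l eps q).
  { intros l l' eps eps' q Hl Heps Hq i Hi. specialize (Hq i (Hl i Hi)). lra. }
  (* [rho] is the supremum, over finite relaxed systems, of the infimum of [F q (y i0)] among their
     solutions; the constraint at [i0] keeps it finite. For a system nearly attaining [rho], two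
     distant near-minimisers would yield by [cat_convex] a solution below [rho - mu / 2], so
     near-minimisers lie close together. *)
  destruct (completeness (fun v => exists l eps, 0 < eps /\
    forall q, C l eps q -> v <= F q (y i0))) as [rho [Hub Hlub]].
  - exists (c i0 + 1). intros v (l & eps & He & Hv).
    assert (Hm : 0 < Rmin eps 1) by (apply Rmin_glb_lt; lra).
    pose proof (Rmin_l eps 1). pose proof (Rmin_r eps 1).
    destruct (Hfin (i0 :: l) (Rmin eps 1) Hm) as [q Hq].
    assert (v <= F q (y i0)).
    { apply Hv. apply Csub with (3 := Hq); [intros; now right | lra]. }
    specialize (Hq i0 (or_introl eq_refl)). lra.
  - exists 0, nil, 1. split; [lra |]. intros q _. apply F_ge0.
  - set (D := fun A : Y -> Prop => exists l eps eta, 0 < eps /\ 0 < eta /\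
      forall q, A q <-> C l eps q /\ F q (y i0) < rho + eta).
    destruct (cantor_intersection D HY) as [q Hq].
    + intros A (l & eps & eta & He & Heta & HA). apply NNPP. intros N.
      assert (rho + eta <= rho); [| lra]. apply Hub. exists l, eps. split; [exact He |].
      intros q Hq. destruct (Rle_dec (rho + eta) (F q (y i0))) as [h | h]; [exact h |].
      exfalso. apply N. exists q. apply HA. split; [exact Hq | lra].
    + intros A A' (l & eps & eta & He & Heta & HA) (l' & eps' & eta' & He' & Heta' & HA').
      exists (fun q => C (l ++ l') (Rmin eps eps') q /\ F q (y i0) < rho + Rmin eta eta').
      split.
      * exists (l ++ l'), (Rmin eps eps'), (Rmin eta eta').
        repeat split; try (apply Rmin_glb_lt; assumption); tauto.
      * intros q [Hq1 Hq2]. pose proof (Rmin_l eps eps'). pose proof (Rmin_r eps eps').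
        pose proof (Rmin_l eta eta'). pose proof (Rmin_r eta eta').
        split; [apply HA | apply HA']; (split; [| lra]);
          apply Csub with (3 := Hq1); try lra; intros; apply in_or_app; auto.
    + intros d Hd. destruct (cat_convex e Y F HF d Hd) as (mu & Hmu & Hconv).
      destruct (classic (exists l eps, 0 < eps /\
        forall q, C l eps q -> rho - mu / 2 <= F q (y i0))) as [(l & eps & He & Hl) | N].
      * exists (fun q => C l eps q /\ F q (y i0) < rho + mu / 2). split.
        { exists l, eps, (mu / 2). repeat split; try lra; tauto. }
        intros q z [Hq1 Hq2] [Hz1 Hz2].
        destruct (Rlt_dec (mdist q z) d) as [h | h]; [exact h | exfalso].
        destruct (Hconv q z ltac:(lra)) as [w Hw].
        assert (Cw : C l eps w).
        { intros i Hi. specialize (Hw (y i)). specialize (Hq1 i Hi).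
          specialize (Hz1 i Hi). lra. }
        specialize (Hl w Cw). specialize (Hw (y i0)). lra.
      * exfalso. assert (rho <= rho - mu / 2); [| lra].
        apply Hlub. intros v (l & eps & He & Hv).
        destruct (Rle_dec v (rho - mu / 2)) as [h | h]; [exact h | exfalso].
        apply N. exists l, eps. split; [exact He |]. intros q Hq. specialize (Hv q Hq). lra.
    + exists q. intros i. apply (cat_closed e Y F HF). intros delta Hdelta.
      destruct (Hq (fun q => C [i] delta q /\ F q (y i0) < rho + 1)) with (d := delta)
        as (q' & [Hq1 _] & Hq2).
      * exists [i], delta, 1. repeat split; try lra; tauto.
      * exact Hdelta.
      * exists q'. split; [exact Hq2 | apply Hq1; now left].
Qed.

End OnePoint.

(* The inequality of [hinge_dsum_ge0] for a cost [c] on a set without metric. *)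
Definition barycentric (e : R) {Z : Type} (c : Z -> Z -> R) : Prop :=
  forall (p : Z) (I : Type) (z : I -> Z) (mu : I -> R) (l : list I),
  (forall i, In i l -> 0 <= mu i) ->
  dsum (fun i j => mu i * mu j * c (z i) (z j)) l <=
    2 * lsum mu l * lsum (fun i => mu i * c (z i) p) l
    + e * lsum (fun i => mu i * c (z i) p) l * lsum (fun i => mu i * c (z i) p) l.

(** Zorn's lemma on graphs, a maximal one being total by the one-point extension. [G] joins the
    prescribed relation [G0] to every candidate [S], so a maximal [S] extends the data
    automatically. Single-valuedness needs no separate care: [c z z = 0] forces two values at [z] to
    coincide. *)
Theorem kirszbraun (e : R) (Y : MetricSpace) (f : R -> R) (Z : Type)
    (c : Z -> Z -> R) (G0 : Z -> Y -> Prop) :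
  0 <= e -> gauge f -> cat_kernel e Y (fun x y => f (mdist x y)) -> complete Y ->
  (forall z w, 0 <= c z w) -> (forall z w, c z w = c w z) -> (forall z, c z z = 0) ->
  barycentric e c ->
  (exists z y, G0 z y) ->
  (forall z y w y', G0 z y -> G0 w y' -> f (mdist y y') <= c z w) ->
  exists phi : Z -> Y, (forall z y, G0 z y -> phi z = y) /\
    forall z w, f (mdist (phi z) (phi w)) <= c z w.
Proof.
  intros He Hf HY HYc c_ge0 c_sym c_refl Hbar (z0 & y0 & Hz0) HG0.
  set (G := fun (S : Z * Y -> Prop) s => S s \/ G0 (fst s) (snd s)).
  set (P := fun S : Z * Y -> Prop => forall s t, G S s -> G S t ->
    f (mdist (snd s) (snd t)) <= c (fst s) (fst t)).
  destruct (classical_sets.Zorn_bigcup (T := Z * Y) (P := P)) as (S & HS & Smax).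
  { intros U HU Utot s t Hs Ht.
    (* Two points of the union lie over one member of the chain unless both come from [G0]; the
       second case also covers the empty chain. *)
    assert (Hst : exists S, P S /\ G S s /\ G S t \/ G (fun _ => False) s /\ G (fun _ => False) t).
    { destruct Hs as [[S1 HS1 Hs] | Hs], Ht as [[S2 HS2 Ht] | Ht].
      - destruct (Utot S1 S2 HS1 HS2) as [h | h].
        + exists S2. left. split; [now apply HU |]. split; left; [now apply h | exact Ht].
        + exists S1. left. split; [now apply HU |]. split; left; [exact Hs | now apply h].
      - exists S1. left. split; [now apply HU |]. split; [now left | now right].
      - exists S2. left. split; [now apply HU |]. split; [now right | now left].
      - exists (fun _ => False). right. split; now right. }
    destruct Hst as [S [(HP & h1 & h2) | [[[] | h1] [[] | h2]]]].
    - now apply HP.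
    - now apply HG0. }
  assert (total : forall z, exists y, G S (z, y)).
  { intros z. set (I := {s : Z * Y | G S s}).
    destruct (one_point_compactness e Y _ HY (fun i : I => snd (proj1_sig i))
      (fun i => c z (fst (proj1_sig i))) (exist _ (z0, y0) (or_intror Hz0)) HYc) as [q Hq].
    - intros l eps Heps. apply (finite_one_point e Y _ He HY);
        [exact (inhabits y0) | intros; apply c_ge0 | | exact Heps].
      + intros mu Hmu. apply Rle_trans with (dsum (fun i j : I => mu i * mu j *
          c (fst (proj1_sig i)) (fst (proj1_sig j))) l).
        * apply lsum_le. intros i Hi. apply lsum_le. intros j Hj.
          apply Rmult_le_compat_l; [apply Rmult_le_pos; auto |].
          apply HS; apply proj2_sig.
        * rewrite (lsum_ext (fun i : I => mu i * c z (fst (proj1_sig i)))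
            (fun i => mu i * c (fst (proj1_sig i)) z)) by (intros; now rewrite c_sym).
          now apply Hbar.
    - exists q. apply NNPP. intros N.
      assert (Hq' : forall s, G S s -> f (mdist q (snd s)) <= c z (fst s))
        by (intros s Hs; exact (Hq (exist _ s Hs))).
      apply (Smax (fun s => S s \/ s = (z, q))).
      + split; [intros s Hs; now left |]. intros h. apply N. left. apply h. now right.
      + assert (cases : forall s, G (fun s => S s \/ s = (z, q)) s -> G S s \/ s = (z, q)).
        { intros s [[Hs | Hs] | Hs]; [left; now left | now right | left; now right]. }
        intros s t Hs Ht.
        destruct (cases s Hs) as [Hs' | ->], (cases t Ht) as [Ht' | ->]; simpl.
        * now apply HS.
        * rewrite mdist_sym, c_sym. now apply Hq'.
        * now apply Hq'.
        * rewrite c_refl, mdist_refl, (gauge_zero f Hf). lra. }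
  destruct (choice _ total) as [phi Hphi]. exists phi. split.
  - intros z y Hy. apply mdist_eq0. apply Rle_antisym; [| apply mdist_ge0].
    apply (gauge_le_inv f Hf); [apply mdist_ge0 | lra |].
    rewrite (gauge_zero f Hf), <- (c_refl z).
    exact (HS (z, phi z) (z, y) (Hphi z) (or_intror Hy)).
  - intros z w. exact (HS _ _ (Hphi z) (Hphi w)).
Qed.

(** * Extending all maps at once *)

(** Summed against [mu i * mu j], the triangle inequality through [p] gives exactly the linear term
    [2 * M * k]; the quadratic term only grows, both sums being nonnegative. *)
Lemma barycentric_plus_pseudometric (e : R) {Z : Type} (c K : Z -> Z -> R) :
  0 <= e -> (forall z w, 0 <= c z w) -> (forall z w, 0 <= K z w) ->
  (forall z w v, K z w <= K z v + K w v) ->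
  barycentric e c -> barycentric e (fun z w => c z w + K z w).
Proof.
  intros He Hc HK Htri Hbar p I z mu l Hmu.
  specialize (Hbar p I z mu l Hmu).
  set (M := lsum mu l) in *. set (a := lsum (fun i => mu i * c (z i) p) l) in *.
  set (k := lsum (fun i => mu i * K (z i) p) l).
  assert (E : lsum (fun i => mu i * (c (z i) p + K (z i) p)) l = a + k).
  { unfold a, k. rewrite <- lsum_plus. apply lsum_ext. intros; ring. }
  rewrite E.
  assert (a_ge0 : 0 <= a) by (apply lsum_ge0; intros; apply Rmult_le_pos; auto).
  assert (k_ge0 : 0 <= k) by (apply lsum_ge0; intros; apply Rmult_le_pos; auto).
  assert (HKd : dsum (fun i j => mu i * mu j * K (z i) (z j)) l <= 2 * M * k).
  { replace (2 * M * k) with (lsum (fun i => k * mu i + M * (mu i * K (z i) p)) l)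
      by (rewrite lsum_plus, !lsum_scal; fold M k; ring).
    apply lsum_le. intros i Hi.
    replace (k * mu i + M * (mu i * K (z i) p)) with
      (lsum (fun j => mu i * (mu j * K (z j) p) + mu i * K (z i) p * mu j) l)
      by (rewrite lsum_plus, !lsum_scal; fold M k; ring).
    apply lsum_le. intros j Hj.
    assert (P : 0 <= mu i * mu j) by (apply Rmult_le_pos; auto).
    apply Rmult_le_compat_l with (2 := Htri (z i) (z j) p) in P. lra. }
  assert (E2 : dsum (fun i j => mu i * mu j * (c (z i) (z j) + K (z i) (z j))) l =
    dsum (fun i j => mu i * mu j * c (z i) (z j)) l
    + dsum (fun i j => mu i * mu j * K (z i) (z j)) l).
  { unfold dsum. rewrite <- lsum_plus. apply lsum_ext. intros i _.
    rewrite <- lsum_plus. apply lsum_ext. intros; ring. }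
  rewrite E2.
  assert (e * (a * a) <= e * ((a + k) * (a + k))) by (apply Rmult_le_compat_l; [lra | nra]).
  lra.
Qed.

Lemma cbb_barycentric (e : R) (X : Type) (F : X -> X -> R) :
  0 <= e -> cbb_kernel e F -> barycentric e F.
Proof.
  intros He HF p I x mu l Hmu.
  assert (G := hinge_dsum_ge0 e X F p He HF mu x l Hmu).
  rewrite dsum_hinge in G. lra.
Qed.

Lemma Rmin1_lipschitz (x y : R) : Rabs (Rmin x 1 - Rmin y 1) <= Rabs (x - y).
Proof.
  unfold Rmin. destruct (Rle_dec x 1), (Rle_dec y 1); unfold Rabs;
    repeat destruct (Rcase_abs _); lra.
Qed.

(** * The pseudo-metric on bounded maps *)

Section BoundedMaps.
Context (Y : MetricSpace) (y0 : Y) (D : Type) (N : (D -> Y) -> Prop) (q : R -> R).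
Hypothesis N_bounded : forall g, N g -> exists M, forall a, mdist (g a) y0 <= M.
Hypothesis D_inhabited : inhabited D.
Hypothesis q_ge0 : forall r, 0 <= r -> 0 <= q r.
Hypothesis q_mono : forall r s, 0 <= r -> r <= s -> q r <= q s.

(** At [w = u] this is [q (mdist u y0)] times the truncated distance from [u] to [v], the shape of
    the bound in [gauge_slope]. *)
Definition bump (u v w : Y) : R :=
  q (mdist w y0) * Rabs (Rmin (mdist u w) 1 - Rmin (mdist v w) 1).

Lemma bump_ge0 (u v w : Y) : 0 <= bump u v w.
Proof. apply Rmult_le_pos; [apply q_ge0, mdist_ge0 | apply Rabs_pos]. Qed.

(** Either both distances to [w] are at least [1] and the truncations cancel, or [w] is within [1]
    of one of the points, hence within [R0 + 1] of [y0], which bounds the weight. *)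
Lemma bump_le (u v w : Y) (R0 : R) :
  mdist u y0 <= R0 -> mdist v y0 <= R0 -> bump u v w <= q (R0 + 1) * mdist u v.
Proof.
  intros Hu Hv. unfold bump.
  pose proof (mdist_ge0 Y u y0) as Pu. pose proof (mdist_ge0 Y w y0) as Pw.
  pose proof (mdist_ge0 Y u v) as Puv.
  assert (Q : 0 <= q (R0 + 1)) by (apply q_ge0; lra).
  assert (Rhs : 0 <= q (R0 + 1) * mdist u v) by (apply Rmult_le_pos; lra).
  pose proof (mdist_tri Y w u y0) as T1. rewrite (mdist_sym Y w u) in T1.
  pose proof (mdist_tri Y w v y0) as T2. rewrite (mdist_sym Y w v) in T2.
  assert (L : Rabs (Rmin (mdist u w) 1 - Rmin (mdist v w) 1) <= mdist u v).
  { apply Rle_trans with (1 := Rmin1_lipschitz _ _).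
    pose proof (mdist_tri Y u v w). pose proof (mdist_tri Y v u w) as T.
    rewrite (mdist_sym Y v u) in T. apply Rabs_le. lra. }
  destruct (Rle_dec 1 (mdist u w)), (Rle_dec 1 (mdist v w)).
  { rewrite !Rmin_right by lra. rewrite Rminus_diag, Rabs_R0. lra. }
  all: apply Rmult_le_compat; [apply q_ge0; lra | apply Rabs_pos | apply q_mono; lra | exact L].
Qed.

(** [K] is the supremum of [bump] over arguments and test points, finite because the maps are
    bounded. Continuity is local: the maps close to a fixed [g] have their values in one ball around
    [y0], where [bump_le] supplies a Lipschitz constant. *)
Lemma bounded_maps_pseudometric :
  exists K : {g | N g} -> {g | N g} -> R,
    (forall g h, 0 <= K g h) /\ (forall g, K g g = 0) /\
    (forall g h, K g h = K h g) /\
    (forall g h k, K g h <= K g k + K h k) /\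
    (forall g h a w, bump (proj1_sig g a) (proj1_sig h a) w <= K g h) /\
    (forall g eps, 0 < eps -> exists delta, 0 < delta /\
       forall h, sup_le (proj1_sig g) (proj1_sig h) delta -> K g h <= eps).
Proof.
  set (E := fun (gh : {g | N g} * {g | N g}) v => exists a w,
    v = bump (proj1_sig (fst gh) a) (proj1_sig (snd gh) a) w).
  assert (lub : forall gh, exists k, is_lub (E gh) k).
  { intros [[g Hg] [h Hh]]. destruct (completeness (E (exist _ g Hg, exist _ h Hh))) as [k Hk].
    - destruct (N_bounded g Hg) as [Mg Bg], (N_bounded h Hh) as [Mh Bh].
      exists (q (Rmax Mg Mh + 1) * (2 * Rmax Mg Mh)). intros v (a & w & ->). simpl.
      specialize (Bg a). specialize (Bh a).
      pose proof (Rmax_l Mg Mh). pose proof (Rmax_r Mg Mh).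
      pose proof (mdist_ge0 Y (g a) y0).
      apply Rle_trans with (1 := bump_le (g a) (h a) w (Rmax Mg Mh) ltac:(lra) ltac:(lra)).
      apply Rmult_le_compat_l; [apply q_ge0; lra |].
      pose proof (mdist_tri Y (g a) y0 (h a)) as T. rewrite (mdist_sym Y y0) in T. lra.
    - destruct D_inhabited as [a]. exists (bump (g a) (h a) y0), a, y0. reflexivity.
    - exists k. exact Hk. }
  destruct (choice _ lub) as [K0 HK0]. set (K := fun g h => K0 (g, h)).
  assert (K_ge : forall g h a w, bump (proj1_sig g a) (proj1_sig h a) w <= K g h).
  { intros g h a w. apply (HK0 (g, h)). exists a, w. reflexivity. }
  assert (K_le : forall g h B, (forall a w, bump (proj1_sig g a) (proj1_sig h a) w <= B) ->
    K g h <= B).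
  { intros g h B HB. apply (HK0 (g, h)). intros v (a & w & ->). apply HB. }
  assert (K_ge0 : forall g h, 0 <= K g h).
  { intros g h. destruct D_inhabited as [a]. apply Rle_trans with (2 := K_ge g h a y0).
    apply bump_ge0. }
  exists K. repeat apply conj; try assumption.
  - intros g. apply Rle_antisym; [| apply K_ge0]. apply K_le. intros a w. unfold bump.
    rewrite Rminus_diag, Rabs_R0. lra.
  - assert (S : forall g h, K g h <= K h g).
    { intros g h. apply K_le. intros a w. apply Rle_trans with (2 := K_ge h g a w).
      unfold bump. rewrite Rabs_minus_sym. lra. }
    intros g h. apply Rle_antisym; apply S.
  - intros g h k. apply K_le. intros a w.
    pose proof (K_ge g k a w) as K1. pose proof (K_ge h k a w) as K2. unfold bump in *.
    pose proof (q_ge0 _ (mdist_ge0 Y w y0)) as Q.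
    set (G := Rmin (mdist (proj1_sig g a) w) 1) in *.
    set (H := Rmin (mdist (proj1_sig h a) w) 1) in *.
    set (L := Rmin (mdist (proj1_sig k a) w) 1) in *.
    assert (T : Rabs (G - H) <= Rabs (G - L) + Rabs (H - L)).
    { rewrite (Rabs_minus_sym H L). replace (G - H) with ((G - L) + (L - H)) by ring.
      apply Rabs_triang. }
    apply Rmult_le_compat_l with (r := q (mdist w y0)) in T; lra.
  - intros g eps He. destruct (N_bounded _ (proj2_sig g)) as [M BM].
    (* The extra [1] leaves room for the maps [h] within [delta <= 1] of [g]. *)
    set (R0 := Rabs M + 1).
    assert (HR0 : 0 <= R0) by (unfold R0; pose proof (Rabs_pos M); lra).
    assert (Q : 0 <= q (R0 + 1)) by (apply q_ge0; lra).
    set (delta := Rmin 1 (eps / (q (R0 + 1) + 1))).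
    assert (Hd : 0 < delta) by (apply Rmin_glb_lt; [lra | apply Rdiv_lt_0_compat; lra]).
    exists delta. split; [exact Hd |]. intros h Hgh. apply K_le. intros a w.
    specialize (Hgh a). specialize (BM a). pose proof (Rle_abs M).
    assert (Hd1 : delta <= 1) by apply Rmin_l.
    pose proof (mdist_tri Y (proj1_sig h a) (proj1_sig g a) y0) as T.
    rewrite (mdist_sym Y (proj1_sig h a) (proj1_sig g a)) in T.
    assert (B := bump_le (proj1_sig g a) (proj1_sig h a) w R0
      ltac:(unfold R0; lra) ltac:(unfold R0; lra)).
    assert (E1 : (q (R0 + 1) + 1) * (eps / (q (R0 + 1) + 1)) = eps) by (field; lra).
    assert (Hd2 : delta <= eps / (q (R0 + 1) + 1)) by apply Rmin_r.
    assert (Hm : q (R0 + 1) * mdist (proj1_sig g a) (proj1_sig h a) <= q (R0 + 1) * delta)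
      by (apply Rmult_le_compat_l; lra).
    assert ((q (R0 + 1) + 1) * delta <= (q (R0 + 1) + 1) * (eps / (q (R0 + 1) + 1)))
      by (apply Rmult_le_compat_l; lra).
    lra.
Qed.

(* Of [u] and [v'], move the one farther from [y0]: its weight in [bump] controls
   the change of [f]. *)
Lemma bump_exchange (f : R -> R) (u u' v v' : Y) (k : R) :
  (forall R0 r r' d, 0 <= r <= 2 * R0 -> 0 <= r' -> 0 <= d -> r <= r' + d ->
      f r - f r' <= q R0 * Rmin d 1) ->
  (forall w, bump u u' w <= k) -> (forall w, bump v v' w <= k) ->
  f (mdist u v') <= Rmax (f (mdist u' v')) (f (mdist u v)) + k.
Proof.
  intros Hf Hu Hv. pose proof (mdist_tri Y u y0 v') as T. rewrite (mdist_sym Y y0) in T.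
  pose proof (Rmax_l (f (mdist u' v')) (f (mdist u v))).
  pose proof (Rmax_r (f (mdist u' v')) (f (mdist u v))).
  assert (E : forall d, 0 <= d -> Rabs (Rmin d 1 - Rmin 0 1) = Rmin d 1).
  { intros d Hd. rewrite (Rmin_left 0) by lra. rewrite Rminus_0_r. apply Rabs_right.
    apply Rle_ge, Rmin_glb; lra. }
  destruct (Rle_dec (mdist v' y0) (mdist u y0)).
  - assert (f (mdist u v') - f (mdist u' v') <= q (mdist u y0) * Rmin (mdist u u') 1).
    { apply Hf; try apply mdist_ge0; [| rewrite Rplus_comm; apply mdist_tri].
      split; [apply mdist_ge0 | lra]. }
    specialize (Hu u). unfold bump in Hu.
    rewrite Rabs_minus_sym, mdist_refl, E, (mdist_sym Y u' u) in Hu by apply mdist_ge0. lra.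
  - assert (f (mdist u v') - f (mdist u v) <= q (mdist v' y0) * Rmin (mdist v v') 1).
    { apply Hf; try apply mdist_ge0; [| apply mdist_tri].
      split; [apply mdist_ge0 | lra]. }
    specialize (Hv v'). unfold bump in Hv.
    rewrite mdist_refl, E in Hv by apply mdist_ge0. lra.
Qed.

End BoundedMaps.

Lemma continuous_extension (e : R) (f : R -> R) (X Y : MetricSpace) (A : X -> Prop) :
  0 <= e -> gauge f ->
  cbb_kernel e (fun x y : X => f (mdist x y)) ->
  cat_kernel e Y (fun x y => f (mdist x y)) ->
  complete Y -> (exists a, A a) ->
  exists alpha : (sub X A -> Y) -> (X -> Y),
    (forall g, inN (sub_dist X A) g -> inN (@mdist X) (alpha g)) /\
    (forall g, inN (sub_dist X A) g ->
       forall eps, 0 < eps -> exists delta, 0 < delta /\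
         forall h, inN (sub_dist X A) h -> sup_le g h delta ->
           sup_le (alpha g) (alpha h) eps) /\
    (forall g, inN (sub_dist X A) g ->
       forall a : sub X A, alpha g (proj1_sig a) = g a).
Proof.
  intros He Hf HX HY HYc [a0 Ha0]. pose (s0 := exist A a0 Ha0 : sub X A).
  (* If [Y] is empty, there is no map at all from the nonempty [A]; evaluation at [s0] just provides
     a term of the right type. *)
  destruct (classic (inhabited Y)) as [[y0] | NY].
  2:{ exists (fun g _ => g s0). repeat split; intros; exfalso; apply NY; constructor; auto. }
  destruct (gauge_slope f Hf) as (q & q_ge0 & q_mono & q_slope).
  pose (N := fun g : sub X A -> Y => inN (sub_dist X A) g).
  destruct (bounded_maps_pseudometric Y y0 (sub X A) N q)
    as (K & K_ge0 & K_refl & K_sym & K_tri & K_bump & K_cont); try assumption.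
  { intros g [[M HM] _]. exists (M + mdist (g s0) y0). intros a.
    pose proof (mdist_tri Y (g a) (g s0) y0). specialize (HM a s0). lra. }
  { exact (inhabits s0). }
  assert (Hcst : N (fun _ => y0)).
  { split.
    - exists 0. intros. rewrite mdist_refl. lra.
    - intros a a'. rewrite mdist_refl. apply mdist_ge0. }
  set (cst := exist N (fun _ => y0) Hcst).
  set (c := fun z w : {g | N g} * X => f (mdist (snd z) (snd w)) + K (fst z) (fst w)).
  set (G0 := fun (z : {g | N g} * X) y =>
    (exists a : sub X A, snd z = proj1_sig a /\ y = proj1_sig (fst z) a) \/
    (fst z = cst /\ y = y0)).
  assert (f_ge0 : forall x x' : X, 0 <= f (mdist x x')) by (intros; apply (cbb_ge0 e _ HX)).
  assert (f0 := gauge_zero f Hf).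
  assert (exch : forall (g h : {g | N g}) (a b : sub X A),
    f (mdist (proj1_sig g a) (proj1_sig h b)) <=
    Rmax (f (mdist (proj1_sig h a) (proj1_sig h b)))
         (f (mdist (proj1_sig g a) (proj1_sig g b))) + K g h).
  { intros g h a b. apply (bump_exchange Y y0 q f _ _ _ _ _ q_slope); intros w; apply K_bump. }
  (* With equal arguments both entries of the maximum in [exch] are [f 0 = 0]. This makes the two
     clauses of [G0] compatible. *)
  assert (exch0 : forall (g : {g | N g}) (b : sub X A),
    f (mdist y0 (proj1_sig g b)) <= K cst g).
  { intros g b. pose proof (exch cst g b b) as h. simpl in h.
    rewrite !mdist_refl, f0 in h. rewrite Rmax_left in h by lra. lra. }
  destruct (kirszbraun e Y f _ c G0 He Hf HY HYc) as (phi & phi_ext & phi_le).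
  - intros z w. apply Rplus_le_le_0_compat; auto.
  - intros z w. unfold c. now rewrite mdist_sym, K_sym.
  - intros z. unfold c. rewrite mdist_refl, K_refl. lra.
  - apply (barycentric_plus_pseudometric e
      (fun z w : {g | N g} * X => f (mdist (snd z) (snd w))) (fun z w => K (fst z) (fst w))); auto.
    intros p I z. exact (cbb_barycentric e X _ He HX (snd p) I (fun i => snd (z i))).
  - exists (cst, a0), y0. now right.
  - intros [g x] y [h x'] y' [(a & Ex & Ey) | [Eg Ey]] [(b & Ex' & Ey') | [Eh Ey']];
      unfold c; simpl in *; subst.
    + apply Rle_trans with (1 := exch g h a b). apply Rplus_le_compat_r.
      apply Rmax_lub; apply (gauge_mono f Hf); try apply mdist_ge0;
        [apply (proj2_sig h) | apply (proj2_sig g)].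
    + rewrite mdist_sym, K_sym. pose proof (exch0 g a). pose proof (f_ge0 (proj1_sig a) x'). lra.
    + pose proof (exch0 h b). pose proof (f_ge0 x (proj1_sig b)). lra.
    + rewrite mdist_refl, f0. pose proof (f_ge0 x x'). pose proof (K_ge0 cst cst). lra.
  (* Outside N(A,Y) the value [y0] is a mere default. *)
  - exists (fun g x => match excluded_middle_informative (N g) with
      | left Hg => phi (exist N g Hg, x) | right _ => y0 end).
    repeat apply conj.
    + intros g Hg. destruct (excluded_middle_informative (N g)) as [Ng | Ng]; [| now elim Ng].
      set (gN := exist N g Ng). split.
      (* Against [(cst, x)], with the same [x], the cost reduces to [K gN cst], which does not
         depend on [x]. *)
      * destruct (gauge_proper f Hf (K gN cst)) as [M HM]. exists (2 * M).
        assert (B : forall x, mdist (phi (gN, x)) y0 <= M).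
        { intros x. apply HM; [apply mdist_ge0 |].
          rewrite <- (phi_ext (cst, x) y0) by now right.
          apply Rle_trans with (1 := phi_le _ _). unfold c. simpl.
          rewrite mdist_refl, f0. lra. }
        intros x x'. pose proof (mdist_tri Y (phi (gN, x)) y0 (phi (gN, x'))) as T.
        rewrite (mdist_sym Y y0) in T. pose proof (B x). pose proof (B x'). lra.
      * intros x x'. apply (gauge_le_inv f Hf); try apply mdist_ge0.
        apply Rle_trans with (1 := phi_le _ _). unfold c. simpl. rewrite K_refl. lra.
    + intros g Hg eps Heps.
      destruct (excluded_middle_informative (N g)) as [Ng | Ng]; [| now elim Ng].
      destruct (K_cont (exist N g Ng) (f eps) (gauge_pos f Hf eps Heps)) as (delta & Hd & HK).
      exists delta. split; [exact Hd |]. intros h Hh Hgh x.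
      destruct (excluded_middle_informative (N h)) as [Nh | Nh]; [| now elim Nh].
      apply (gauge_le_inv f Hf); [apply mdist_ge0 | lra |].
      apply Rle_trans with (1 := phi_le _ _). unfold c. simpl. rewrite mdist_refl, f0.
      specialize (HK (exist N h Nh) Hgh). lra.
    + intros g Hg a. destruct (excluded_middle_informative (N g)) as [Ng | Ng]; [| now elim Ng].
      apply phi_ext. left. exists a. split; reflexivity.
Qed.

Theorem theorem3p6 (kappa : R) (X Y : MetricSpace) (A : X -> Prop) :
  kappa <= 0 -> CBB kappa X -> CAT kappa Y -> complete Y ->
  (exists a, A a) ->
  exists alpha : (sub X A -> Y) -> (X -> Y),
    (* alpha maps N(A,Y) into N(X,Y) *)
    (forall g, inN (sub_dist X A) g -> inN (@mdist X) (alpha g)) /\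
    (* alpha is continuous for the sup metrics *)
    (forall g, inN (sub_dist X A) g ->
       forall eps, 0 < eps -> exists delta, 0 < delta /\
         forall h, inN (sub_dist X A) h -> sup_le g h delta ->
           sup_le (alpha g) (alpha h) eps) /\
    (* alpha g extends g *)
    (forall g, inN (sub_dist X A) g ->
       forall a : sub X A, alpha g (proj1_sig a) = g a).
Proof.
  intros [Hk | ->] HX HY HYc HA.
  - apply (continuous_extension 1 (coshf (sqrt (- kappa)))); try assumption; try lra.
    + apply gauge_coshf, sqrt_lt_R0. lra.
    + now apply cbb_kernel_hyperbolic.
    + now apply cat_kernel_hyperbolic.
  - apply (continuous_extension 0 sqf); try assumption; try lra.
    + apply gauge_sqf.
    + now apply cbb_kernel_flat.
    + now apply cat_kernel_flat.
Qed.
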